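(* Let $k$ be a field of prime characteristic $p$ and let $G$ be a pendant cliques graph on the vertex set $[n]=\{1,\dots,n\}$, with binomial edge ideal $J_G\subseteq S=k[x_1,\dots,x_n,y_1,\dots,y_n]$. Then $J_G$ is symbolic $F$-split.
   Context: All graphs are finite and simple. Clique join via a vertex: for a graph $H$, a vertex $v\in V(H)$ and $t\ge 2$, the clique join of $K_t$ on $H$ via $v$ is obtained from $H$ by adding $t-1$ new vertices $u_1,\dots,u_{t-1}$, all edges $\{u_i,v\}$, and all edges $\{u_i,u_j\}$, $i<j$. Pendant cliques graph: a graph obtained from a path $P$ by performing in succession clique joins of some complete graphs $K_{t_1},\dots,K_{t_m}$ via pairwise distinct vertices $v_1,\dots,v_m$ of $P$. Binomial edge ideal: for a graph $G$ on $[n]$, $J_G$ is the ideal of $S$ generated by the binomials $f_{i,j}=x_iy_j-y_ix_j$ with $\{i,j\}\in E(G)$. Symbolic power: if $I$ is an ideal of a Noetherian ring with minimal primes $\mathfrak p_1,\dots,\mathfrak p_r$, then $I^{(m)}=\mathfrak q_1\cap\dots\cap\mathfrak q_r$, where $\mathfrak q_i$ is the $\mathfrak p_i$-primary component of $I^m$; $I^{(0)}$ is the whole ring. Symbolic $F$-split: let $R$ be a reduced Noetherian ring of prime characteristic $p$ and let $R^{1/p}$ be the ring obtained by adjoining all $p$-th roots of elements of $R$. A sequence $\{I_n\}_{n\ge0}$ of ideals of $R$ is an $F$-split filtration if: (1) $I_0=R$; (2) $I_{n+1}\subseteq I_n$ for all $n\ge 0$; (3) $I_nI_m\subseteq I_{n+m}$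 for all $n,m\ge0$; (4) there is a splitting $\phi:R^{1/p}\to R$ of the inclusion $R\subseteq R^{1/p}$ ($\phi$ is $R$-linear with $\phi|_R=\mathrm{id}_R$) such that $\phi((I_{np+1})^{1/p})\subseteq I_{n+1}$ for every $n\ge0$. An ideal $I\subseteq R$ is symbolic $F$-split if $\{I^{(n)}\}_{n\ge0}$ is an $F$-split filtration. *)

(* Defs.v *)
From HB Require Import structures.
From mathcomp Require Export all_boot all_algebra.
From mathcomp Require Export mpoly.
From mathcomp Require Export boolp classical_sets.

Set Implicit Arguments.
Unset Strict Implicit.
Unset Printing Implicit Defensive.

Import GRing.Theory.

Local Open Scope classical_set_scope.
Local Open Scope ring_scope.

(** * Ideals *)

(* [idealr_closed] of ring_quotient is for proper ideals given by boolean
   predicates; here the unit ideal must be allowed. *)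
Section Ideals.
Variable R : comNzRingType.
Implicit Types (I J P Q X : set R) (m : nat).

Definition is_ideal I : Prop :=
  [/\ I 0, forall x y, I x -> I y -> I (x + y) & forall a x, I x -> I (a * x)].

Definition ideal_gen X : set R :=
  \bigcap_(I in [set I | is_ideal I /\ X `<=` I]) I.

Definition ideal_mul I J : set R :=
  ideal_gen [set z | exists x y, [/\ I x, J y & z = x * y]].

Definition ideal_exp I m : set R := iter m (ideal_mul I) setT.

Definition radical I : set R := [set x | exists m, I (x ^+ m)].

Definition prime_ideal P : Prop :=
  [/\ is_ideal P, ~ P 1 & forall x y, P (x * y) -> P x \/ P y].

Definition primary_ideal Q : Prop :=
  [/\ is_ideal Q, ~ Q 1 & forall x y, Q (x * y) -> Q x \/ radical Q y].

Definition minimal_prime I P : Prop :=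
  [/\ prime_ideal P, I `<=` P &
      forall P', prime_ideal P' -> I `<=` P' -> P' `<=` P -> P' = P].

Definition minimal_primary_decomposition J r (Q : 'I_r -> set R) : Prop :=
  [/\ forall i, primary_ideal (Q i),
      J = \bigcap_i Q i,
      injective (fun i => radical (Q i)) &
      forall i, ~ (\bigcap_(j in [set j | j != i]) Q j `<=` Q i)].

Definition primary_component J P Q : Prop :=
  exists r (D : 'I_r -> set R) (i : 'I_r),
    [/\ minimal_primary_decomposition J D, Q = D i & radical Q = P].

(* Over a Noetherian ring, for each minimal prime P of I and each m > 0, there
   is exactly one Q with [primary_component (ideal_exp I m) P Q]. *)
Definition symbolic_power I m : set R :=
  if m is 0 then setT else
    \bigcap_(Q in [set Q | exists2 P, minimal_prime I P &
                            primary_component (ideal_exp I m) P Q]) Q.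

End Ideals.

(** * The ring of p-th roots *)

(* R^{1/p}, for R of characteristic p: the carrier is R, an element a standing
   for its p-th root a^{1/p}.  The inclusion R -> R^{1/p}, r = (r^p)^{1/p}, is
   then the Frobenius map, which is injective when R is reduced. *)
Definition pth_root_ring (R : comNzRingType) (p : nat)
  (charRp : p \in [pchar R]) : Type := R.

Section PthRoots.
Variables (R : comNzRingType) (p : nat) (charRp : p \in [pchar R]).
Local Notation R1p := (pth_root_ring charRp).

HB.instance Definition _ := GRing.ComNzRing.on R1p.

Definition pth_root (a : R) : R1p := a.
Definition pth_incl (r : R) : R1p := pFrobenius_aut charRp r.

Fact pth_incl_additive : {morph pth_incl : x y / x - y}.
Proof. exact: (rmorphB (pFrobenius_aut charRp)). Qed.

Fact pth_incl_multiplicative : multiplicative pth_incl.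
Proof.
split; last exact: (rmorph1 (pFrobenius_aut charRp)).
exact: (rmorphM (pFrobenius_aut charRp)).
Qed.

HB.instance Definition _ :=
  GRing.isZmodMorphism.Build R R1p pth_incl pth_incl_additive.
HB.instance Definition _ :=
  GRing.isMonoidMorphism.Build R R1p pth_incl
    (pth_incl_multiplicative.2, pth_incl_multiplicative.1).

Definition pth_scale (r : R) (a : R1p) : R1p := pth_incl r * a.

Fact pth_scaleA r s a : pth_scale r (pth_scale s a) = pth_scale (r * s) a.
Proof. by rewrite /pth_scale rmorphM mulrA. Qed.
Fact pth_scale1 : left_id 1 pth_scale.
Proof. by move=> a; rewrite /pth_scale rmorph1 mul1r. Qed.
Fact pth_scaleDr : right_distributive pth_scale +%R.
Proof. by move=> r a b; rewrite /pth_scale mulrDr. Qed.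
Fact pth_scaleDl a : {morph pth_scale^~ a : r s / r + s}.
Proof. by move=> r s; rewrite /pth_scale rmorphD mulrDl. Qed.

HB.instance Definition _ :=
  GRing.Zmodule_isLmodule.Build R R1p
    pth_scaleA pth_scale1 pth_scaleDr pth_scaleDl.

Lemma pth_scaleE (r : R) (a : R1p) : r *: a = pth_incl r * a.
Proof. by []. Qed.

Lemma pth_rootK (a : R) : pth_root a ^+ p = pth_incl a.
Proof. by rewrite /pth_incl pFrobenius_autE. Qed.

Lemma pth_root_surj (b : R1p) : exists a : R, b = pth_root a.
Proof. by exists b. Qed.

Lemma pth_incl_inj :
  (forall (x : R) m, x ^+ m = 0 -> x = 0) -> injective pth_incl.
Proof.
move=> red x y /eqP; rewrite -subr_eq0 -rmorphB => /eqP eq0.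
by apply/eqP; rewrite -subr_eq0; apply/eqP/(red _ p).
Qed.

End PthRoots.

(** * Symbolic F-split ideals *)

Section FSplit.
Variables (R : comNzRingType) (p : nat) (charRp : p \in [pchar R]).

(* The definition is used for reduced Noetherian R; reducedness already follows
   from the existence of the splitting phi. *)
Definition F_split_filtration (I : nat -> set R) : Prop :=
  [/\ forall n, is_ideal (I n),
      I 0%N = setT,
      forall n, I n.+1 `<=` I n,
      forall n m, ideal_mul (I n) (I m) `<=` I (n + m)%N &
      exists phi : {linear pth_root_ring charRp -> R^o},
        (forall r : R, phi (pth_incl charRp r) = r) /\
        (forall n, phi @` (pth_root charRp @` I (n * p).+1) `<=` I n.+1)].

Definition symbolic_F_split (I : set R) : Prop :=
  F_split_filtration (symbolic_power I).

End FSplit.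

(** * Graphs *)

Record graph (V : finType) := Graph {
  adj :> rel V;
  adj_sym : ssrbool.symmetric adj;
  adj_irr : irreflexive adj
}.

Definition graph_iso (V W : finType) (G : graph V) (H : graph W) : Prop :=
  exists2 f : V -> W, bijective f & forall u v, G u v = H (f u) (f v).

Section PathGraph.
Variable l : nat.

Definition path_adj : rel 'I_l :=
  fun i j => ((i : nat).+1 == j) || ((j : nat).+1 == i).

Fact path_adj_sym : ssrbool.symmetric path_adj.
Proof. by move=> i j; rewrite /path_adj orbC. Qed.
Fact path_adj_irr : irreflexive path_adj.
Proof. by move=> i; rewrite /path_adj orbb gtn_eqF. Qed.

Definition path_graph := Graph path_adj_sym path_adj_irr.

End PathGraph.

Section CliqueJoin.
Variables (V : finType) (H : graph V) (v : V) (t : nat).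

Definition clique_join_adj : rel (V + 'I_t.-1)%type := fun a b =>
  match a, b with
  | inl x, inl y => H x y
  | inl x, inr _ => x == v
  | inr _, inl y => y == v
  | inr i, inr j => i != j
  end.

Fact clique_join_adj_sym : ssrbool.symmetric clique_join_adj.
Proof. by case=> [x|i] [y|j] //=; [exact: adj_sym | rewrite eq_sym]. Qed.
Fact clique_join_adj_irr : irreflexive clique_join_adj.
Proof. by case=> [x|i] /=; [exact: adj_irr | rewrite eqxx]. Qed.

Definition clique_join := Graph clique_join_adj_sym clique_join_adj_irr.

End CliqueJoin.

(* [clique_joins_of_path H path_vertex used]: H is obtained from the path on l
   vertices by successive clique joins, [path_vertex] locates the vertices of
   that path in H, and [used] is the set of path vertices v_1, ..., v_m via
   which the joins were performed. *)
Inductive clique_joins_of_path (l : nat) :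
  forall V : finType, graph V -> ('I_l -> V) -> {set 'I_l} -> Prop :=
| No_join : clique_joins_of_path (path_graph l) id finset.set0
| Add_join (V : finType) (H : graph V) (path_vertex : 'I_l -> V)
    (used : {set 'I_l}) (v : 'I_l) (t : nat) :
    clique_joins_of_path H path_vertex used ->
    v \notin used -> (2 <= t)%N ->
    clique_joins_of_path (clique_join H (path_vertex v) t)
      (fun i => inl (path_vertex i)) (v |: used)%SET.

Definition pendant_cliques_graph (V : finType) (G : graph V) : Prop :=
  exists (l : nat) (W : finType) (H : graph W) (path_vertex : 'I_l -> W)
    (used : {set 'I_l}),
    [/\ (0 < l)%N, clique_joins_of_path H path_vertex used & graph_iso H G].

(** * Binomial edge ideals *)

(* {mpoly k[n + n]} is k[x_1, ..., x_n, y_1, ..., y_n]. *)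
Section BinomialEdgeIdeal.
Variables (k : fieldType) (n : nat).

Definition xvar (i : 'I_n) : {mpoly k[n + n]} := 'X_(lshift n i).
Definition yvar (i : 'I_n) : {mpoly k[n + n]} := 'X_(rshift n i).

Definition edge_binomial (i j : 'I_n) : {mpoly k[n + n]} :=
  xvar i * yvar j - yvar i * xvar j.

Definition binomial_edge_ideal (G : graph 'I_n) : set {mpoly k[n + n]} :=
  ideal_gen [set f | exists i j, G i j /\ f = edge_binomial i j].

Lemma pchar_mpoly p : p \in [pchar k] -> p \in [pchar {mpoly k[n + n]}].
Proof. exact: (rmorph_pchar (@mpolyC (n + n) k)). Qed.

End BinomialEdgeIdeal.

Arguments binomial_edge_ideal k {n} G.

(* Main.v *)
(* Let the vertices be ordered as w_0, ..., w_m, each clique being listed right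
   after its path vertex, and let
     f = y_(w_0) f_(w_0,w_1) ... f_(w_(m-1),w_m) x_(w_m),
   where the f_(w_i,w_(i+1)) need not all be edge binomials.  For a weight order f
   has initial monomial x_1...x_n y_1...y_n, so a |-> Tr(f^(p-1) a) is, up to a
   choice of a p^-1-linear functional on k, a splitting of Frobenius.
   Let P be a minimal prime of J = J_G and T = {t : x_t, y_t in P}.  Minimality
   of P forces x_t, y_t in J_P for t in T, and puts no vertex with a complete
   neighbourhood in T.  Since an edge of G jumps only over such vertices, J_P is
   generated by the x_t, y_t with t in T and the f_(w_i,w_(i+1)) in J_P with
   w_i, w_(i+1) outside T.  If these are h elements, then f lies in (J_P)^h, because
   f_(w_i,w_(i+1)) contributes one factor for each of its ends in T, or one if it is
   a generator.  Hence f^(p-1) J^(np+1) lies, locally at P, in the power of J_P with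
   exponent h(p-1) + np + 1, which by the pigeonhole principle is contained in the
   Frobenius power (J_P^(n+1))^[p], and the trace maps the latter into J_P^(n+1). *)
From HB Require Import structures.
From mathcomp Require Import ring.
Require Import Defs.

Set Implicit Arguments.
Unset Strict Implicit.
Unset Printing Implicit Defensive.

Import GRing.Theory.

Local Open Scope classical_set_scope.
Local Open Scope ring_scope.

(** * Ideals and their localisations *)

Section IdealTheory.
Variable R : comNzRingType.
Implicit Types (I J P Q A B X : set R) (x y s : R) (m n : nat).

Lemma ideal0 I : is_ideal I -> I 0.
Proof. by case. Qed.

Lemma idealD I x y : is_ideal I -> I x -> I y -> I (x + y).
Proof. by case=> _ + _; apply. Qed.

Lemma idealMl I x y : is_ideal I -> I y -> I (x * y).
Proof. by case=> _ _; apply. Qed.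

Lemma idealMr I x y : is_ideal I -> I x -> I (x * y).
Proof. by move=> idI Ix; rewrite mulrC; apply: idealMl. Qed.

Lemma idealN I x : is_ideal I -> I x -> I (- x).
Proof. by move=> idI Ix; rewrite -mulN1r; apply: idealMl. Qed.

Lemma idealB I x y : is_ideal I -> I x -> I y -> I (x - y).
Proof. by move=> idI Ix Iy; apply: idealD => //; apply: idealN. Qed.

Lemma idealDl I x y : is_ideal I -> I y -> I (x + y) -> I x.
Proof. by move=> idI Iy Ixy; rewrite -(addrK y x); apply: idealB. Qed.

Lemma idealBM I x x' y y' : is_ideal I -> I (x - x') -> I (y - y') ->
  I (x * y - x' * y').
Proof.
move=> idI Ix Iy; have -> : x * y - x' * y' = (x - x') * y + x' * (y - y').
  by rewrite mulrBl mulrBr subrKA.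
by apply: idealD; [|exact: idealMr|exact: idealMl].
Qed.

Lemma ideal_sum I (T : Type) (r : seq T) (C : pred T) (F : T -> R) :
  is_ideal I -> (forall i, C i -> I (F i)) -> I (\sum_(i <- r | C i) F i).
Proof.
move=> idI IF; apply: (big_ind I) => //; first exact: ideal0.
by move=> x y; apply: idealD.
Qed.

Lemma ideal_setT : is_ideal [set: R].
Proof. by split. Qed.

Lemma ideal_bigcap (T : Type) (D : set T) (F : T -> set R) :
  (forall i, D i -> is_ideal (F i)) -> is_ideal (\bigcap_(i in D) F i).
Proof.
move=> idF; split=> [i Di|x y Fx Fy i Di|a x Fx i Di].
- by apply: ideal0; apply: idF.
- by apply: idealD; [apply: idF|apply: Fx|apply: Fy].
- by apply: idealMl; [apply: idF|apply: Fx].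
Qed.

Lemma ideal_setI I J : is_ideal I -> is_ideal J -> is_ideal (I `&` J).
Proof.
move=> idI idJ; split=> [|x y [Ix Jx] [Iy Jy]|a x [Ix Jx]].
- by split; exact: ideal0.
- by split; exact: idealD.
- by split; exact: idealMl.
Qed.

Lemma ideal_gen_ideal X : is_ideal (ideal_gen X).
Proof. by apply: ideal_bigcap => I []. Qed.

Lemma sub_ideal_gen X : X `<=` ideal_gen X.
Proof. by move=> x Xx I [_]; apply. Qed.

Lemma ideal_gen_min X I : is_ideal I -> X `<=` I -> ideal_gen X `<=` I.
Proof. by move=> idI XI x; apply. Qed.

Lemma ideal_mul_ideal I J : is_ideal (ideal_mul I J).
Proof. exact: ideal_gen_ideal. Qed.

Lemma mem_ideal_mul I J x y : I x -> J y -> ideal_mul I J (x * y).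
Proof. by move=> Ix Jy; apply: sub_ideal_gen; exists x, y. Qed.

Lemma ideal_mul_min I J A : is_ideal A ->
  (forall x y, I x -> J y -> A (x * y)) -> ideal_mul I J `<=` A.
Proof.
by move=> idA IJA; apply: ideal_gen_min => // _ [x [y [Ix Jy ->]]]; apply: IJA.
Qed.

Lemma ideal_exp_ideal I m : is_ideal (ideal_exp I m).
Proof. by case: m => [|m]; [exact: ideal_setT|exact: ideal_mul_ideal]. Qed.

Lemma ideal_expS_sub I m : ideal_exp I m.+1 `<=` ideal_exp I m.
Proof.
apply: ideal_mul_min => [|x y _ Iy]; first exact: ideal_exp_ideal.
by apply: idealMl => //; apply: ideal_exp_ideal.
Qed.

Lemma ideal_exp_le I m n : (m <= n)%N -> ideal_exp I n `<=` ideal_exp I m.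
Proof.
move=> /subnK <-; elim: (n - m)%N => [|d IHd] //.
by apply: classical_sets.subset_trans IHd; exact: ideal_expS_sub.
Qed.

Lemma ideal_exp_sub I m : is_ideal I -> (0 < m)%N -> ideal_exp I m `<=` I.
Proof.
move=> idI m_gt0 z /(ideal_exp_le m_gt0); move: z.
by apply: ideal_mul_min => // x y Ix _; apply: idealMr.
Qed.

Lemma ideal_exp1 I x : I x -> ideal_exp I 1 x.
Proof. by move=> Ix; rewrite -[x]mulr1; apply: mem_ideal_mul. Qed.

Lemma ideal_expM I m n x y :
  ideal_exp I m x -> ideal_exp I n y -> ideal_exp I (m + n) (x * y).
Proof.
move=> + Iy; elim: m x => [|m IHm] x Ix.
  by rewrite add0n; apply: idealMl => //; apply: ideal_exp_ideal.
suff : ideal_mul I (ideal_exp I m) `<=` [set z | ideal_exp I (m + n).+1 (z * y)].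
  exact.
apply: ideal_mul_min => [|u v Iu Iv /=]; last first.
  by rewrite -mulrA; apply: mem_ideal_mul => //; apply: IHm.
have idE := ideal_exp_ideal I (m + n).+1.
split=> [|u v|a u] /=; rewrite ?mul0r ?mulrDl -?mulrA.
- exact: ideal0.
- exact: idealD.
- exact: idealMl.
Qed.

Lemma ideal_expX I m n x : ideal_exp I m x -> ideal_exp I (m * n) (x ^+ n).
Proof.
move=> Ix; elim: n => [|n IHn]; first by rewrite muln0.
by rewrite mulnS exprS; apply: ideal_expM.
Qed.

Lemma ideal_exp_prod I (T : Type) (r : seq T) (C : pred T) (F : T -> R)
    (e : T -> nat) :
  (forall i, C i -> ideal_exp I (e i) (F i)) ->
  ideal_exp I (\sum_(i <- r | C i) e i) (\prod_(i <- r | C i) F i).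
Proof.
move=> IF; apply: (big_ind2 (fun m x => ideal_exp I m x)) => //.
by move=> m x n y; apply: ideal_expM.
Qed.

(** For a prime P and an ideal A, the contraction to R of the extension of A to the local ring at
    P. *)
Definition loc P A : set R := [set x | exists2 s, ~ P s & A (s * x)].

Section Loc.
Variable P : set R.
Hypothesis prP : prime_ideal P.

Lemma primeNM x y : ~ P x -> ~ P y -> ~ P (x * y).
Proof. by case: prP => _ _ prM nPx nPy /prM[]. Qed.

Lemma primeN1 : ~ P 1.
Proof. by case: prP. Qed.

Lemma primeNX x m : ~ P x -> ~ P (x ^+ m).
Proof.
move=> nPx; elim: m => [|m IHm]; first by rewrite expr0; exact: primeN1.
by rewrite exprS; exact: primeNM.
Qed.

Lemma primeX x m : P (x ^+ m) -> P x.
Proof. by move=> Pxm; apply: contrapT => nPx; apply: primeNX Pxm. Qed.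

Lemma primeN_prod (T : Type) (r : seq T) (C : pred T) (F : T -> R) :
  (forall i, C i -> ~ P (F i)) -> ~ P (\prod_(i <- r | C i) F i).
Proof.
move=> nPF; apply: (big_ind (fun x => ~ P x)) => //; first exact: primeN1.
exact: primeNM.
Qed.

Lemma sub_loc A : A `<=` loc P A.
Proof. by move=> x Ax; exists 1; [exact: primeN1|rewrite mul1r]. Qed.

Lemma loc_mono A B : A `<=` B -> loc P A `<=` loc P B.
Proof. by move=> AB x [s nPs Asx]; exists s => //; apply: AB. Qed.

Lemma loc_ideal A : is_ideal A -> is_ideal (loc P A).
Proof.
move=> idA; split=> [|x y [s nPs Asx] [t nPt Aty]|a x [s nPs Asx]].
- by apply: sub_loc; apply: ideal0.
- exists (s * t); first exact: primeNM.
  rewrite mulrDr {1}[s * t]mulrC -!mulrA.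
  by apply: idealD => //; apply: idealMl.
- by exists s => //; rewrite mulrCA; apply: idealMl.
Qed.

Lemma locP A s x : ~ P s -> loc P A (s * x) -> loc P A x.
Proof.
move=> nPs [t nPt Atsx]; exists (t * s); first exact: primeNM.
by rewrite -mulrA.
Qed.

Lemma loc_idem A : loc P (loc P A) `<=` loc P A.
Proof. by move=> x [s nPs]; apply: locP. Qed.

Lemma loc_expM A m n x y : loc P (ideal_exp A m) x -> loc P (ideal_exp A n) y ->
  loc P (ideal_exp A (m + n)) (x * y).
Proof.
move=> [s nPs Asx] [t nPt Aty]; exists (s * t); first exact: primeNM.
by rewrite mulrACA; apply: ideal_expM.
Qed.

Lemma loc_expX A m n x : loc P (ideal_exp A m) x ->
  loc P (ideal_exp A (m * n)) (x ^+ n).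
Proof.
move=> [s nPs Asx]; exists (s ^+ n); first exact: primeNX.
by rewrite -exprMn; apply: ideal_expX.
Qed.

Lemma loc_exp_sub A B m : A `<=` loc P B ->
  loc P (ideal_exp A m) `<=` loc P (ideal_exp B m).
Proof.
move=> AB; move=> z Az; apply: loc_idem; move: z Az; apply: loc_mono.
elim: m => [|m IHm]; first by move=> x _; exact: sub_loc.
apply: ideal_mul_min => [|x y Ax Ay].
  by apply: loc_ideal; apply: ideal_exp_ideal.
rewrite -add1n; apply: loc_expM; last exact: IHm.
by move: (AB _ Ax); apply: loc_mono => z; exact: ideal_exp1.
Qed.

End Loc.
End IdealTheory.

(** * Primary decomposition *)

Definition noetherian (R : comNzRingType) : Prop :=
  forall I : nat -> set R, (forall i, is_ideal (I i)) ->
    (forall i, I i `<=` I i.+1) ->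
    exists N, forall i, (N <= i)%N -> I i = I N.

Section PrimaryDecomposition.
Variable R : comNzRingType.
Implicit Types (I J P Q A B X : set R) (x y s : R) (m n : nat).

Lemma noetherian_max (F : set (set R)) J : noetherian R ->
  (forall I, F I -> is_ideal I) -> F J ->
  exists2 I, F I & forall I', F I' -> I `<=` I' -> I' = I.
Proof.
move=> noeR idF FJ; apply: contrapT => nomax.
have step I : exists I', F I -> [/\ F I', I `<=` I' & I' <> I].
  have [FI|nFI] := pselect (F I); last by exists I.
  apply: contrapT => noI'; apply: nomax; exists I => // I' FI' II'.
  by apply: contrapT => neq; apply: noI'; exists I'.
have {step}[g gP] := choice step.
pose C i := iter i g J.
have FC i : F (C i) by elim: i => //= i /gP[].
have CS i : C i `<=` C i.+1 by have [] := gP _ (FC i).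
have [N CN] := noeR C (fun i => idF _ (FC i)) CS.
by have [_ _] := gP _ (FC N); apply; apply: (CN N.+1).
Qed.

Lemma radical_prime Q : primary_ideal Q -> prime_ideal (radical Q).
Proof.
move=> [idQ nQ1 prQ]; split.
- split=> [|x y [m Qx] [n Qy]|a x [m Qx]].
  + by exists 1%N; rewrite expr1; apply: ideal0.
  + exists (m + n)%N; rewrite exprDn; apply: ideal_sum => // i _.
    rewrite -mulr_natr; apply: idealMr => //.
    have [ni|ni] := leqP n i.
      by apply: idealMl => //; rewrite -(subnK ni) exprD; apply: idealMl.
    apply: idealMr => //; rewrite -(@subnK m (m + n - i)%N).
      by rewrite exprD; apply: idealMl.
    by rewrite -addnBA ?leq_addr // ltnW.
  + by exists m; rewrite exprMn; apply: idealMl.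
- by case=> m; rewrite expr1n.
move=> x y [m]; rewrite exprMn => /prQ[Qx|[n Qy]]; first by left; exists m.
by right; exists (m * n)%N; rewrite exprM.
Qed.

Lemma primary_setI A B : primary_ideal A -> primary_ideal B ->
  radical A = radical B ->
  primary_ideal (A `&` B) /\ radical (A `&` B) = radical A.
Proof.
move=> [idA nA1 prA] [idB nB1 prB] eqr.
have radI : radical (A `&` B) = radical A.
  apply/seteqP; split=> x; first by case=> m [Am _]; exists m.
  move=> rAx; have [n Bn] : radical B x by rewrite -eqr.
  case: rAx => m Am; exists (m + n)%N; rewrite exprD.
  by split; [exact: idealMr|exact: idealMl].
split=> //; split; [exact: ideal_setI|by case|].
move=> x y [/prA Axy /prB Bxy]; rewrite radI.
case: Axy => [Ax|]; last by right.
by case: Bxy => [Bx|]; [left|right; rewrite eqr].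
Qed.

Definition irreducible_ideal Q : Prop :=
  forall A B, is_ideal A -> is_ideal B -> Q = A `&` B -> Q = A \/ Q = B.

Definition add_principal Q x : set R :=
  [set z | exists q a, Q q /\ z = q + a * x].

Lemma add_principal_ideal Q x : is_ideal Q -> is_ideal (add_principal Q x).
Proof.
move=> idQ; split.
- by exists 0, 0; rewrite mul0r addr0; split=> //; apply: ideal0.
- move=> _ _ [q [a [Qq ->]]] [r [b [Qr ->]]]; exists (q + r), (a + b).
  by split; [exact: idealD|rewrite mulrDl addrACA].
- move=> c _ [q [a [Qq ->]]]; exists (c * q), (c * a).
  by split; [exact: idealMl|rewrite mulrDr mulrA].
Qed.

Lemma sub_add_principal Q x : Q `<=` add_principal Q x.
Proof. by move=> q Qq; exists q, 0; rewrite mul0r addr0. Qed.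

Lemma mem_add_principal Q x : is_ideal Q -> add_principal Q x x.
Proof. by move=> idQ; exists 0, 1; rewrite mul1r add0r; split=> //; exact: ideal0. Qed.

(** Noether's argument: if xy lies in Q and the chain of the (Q : y^n) is constant from N on, then Q
    is the intersection of Q + (y^N) and Q + (x). *)
Lemma irreducible_primary Q : noetherian R -> is_ideal Q -> ~ Q 1 ->
  irreducible_ideal Q -> primary_ideal Q.
Proof.
move=> noeR idQ nQ1 irrQ; split=> // x y Qxy.
have [Qx|nQx] := pselect (Q x); first by left.
right; pose C n := [set a | Q (a * y ^+ n)].
have idC n : is_ideal (C n).
  rewrite /C; split=> [|a b|a b] /=; rewrite ?mul0r ?mulrDl -?mulrA.
  - exact: ideal0.
  - exact: idealD.
  - exact: idealMl.
have CS n : C n `<=` C n.+1.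
  by move=> a; rewrite /C /= exprSr mulrA => Qa; apply: idealMr.
have [N CN] := noeR C idC CS.
have eqQ : Q = add_principal Q (y ^+ N) `&` add_principal Q x.
  apply/seteqP; split=> z; first by move=> Qz; split; apply: sub_add_principal.
  case=> [[q [a [Qq ->]]] [r [b [Qr eqz]]]].
  apply: idealD => //.
  suff : C N.+1 a by rewrite (CN N.+1).
  rewrite /C /= exprS mulrCA; apply: (@idealDl _ _ _ (y * q)) => //.
    exact: idealMl.
  rewrite addrC -mulrDr eqz mulrDr.
  by apply: idealD; rewrite ?[y * (b * x)]mulrC -?mulrA //; apply: idealMl.
have [eqN|eqx] := irrQ _ _ (add_principal_ideal _ idQ)
  (add_principal_ideal _ idQ) eqQ.
  by exists N; rewrite eqN; apply: mem_add_principal.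
by case: nQx; rewrite eqx; apply: mem_add_principal.
Qed.

Definition primary_decomposition J r (D : 'I_r -> set R) : Prop :=
  (forall i, primary_ideal (D i)) /\ J = \bigcap_i D i.

(** Noetherian induction: a maximal counterexample would be proper and reducible, hence an
    intersection of two larger ideals, which do decompose. *)
Lemma primary_decomposition_exists J : noetherian R -> is_ideal J ->
  exists r (D : 'I_r -> set R), primary_decomposition J D.
Proof.
move=> noeR idJ; apply: contrapT => noJ.
pose F := [set I : set R | is_ideal I /\
  ~ exists r (D : 'I_r -> set R), primary_decomposition I D].
have [I [idI nodec] maxI] := @noetherian_max F J noeR (fun I FI => proj1 FI)
  (conj idJ noJ).
have larger A : is_ideal A -> I `<=` A -> I <> A ->
    exists r (D : 'I_r -> set R), primary_decomposition A D.
  move=> idA IA neqIA; apply: contrapT => noA.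
  by apply: neqIA; rewrite (maxI A).
apply: nodec; have [I1|nI1] := pselect (I 1).
  (* The unit ideal is the empty intersection. *)
  exists 0%N, (fun=> setT); split; first by case.
  apply/seteqP; split=> [x _ [] //|x _].
  by rewrite -[x]mulr1; apply: idealMl.
have [irrI|nirrI] := pselect (irreducible_ideal I).
  exists 1%N, (fun=> I); split=> [_|]; first exact: irreducible_primary.
  by apply/seteqP; split=> [x Ix i _ //|x /(_ ord0 Logic.I)].
have [A [B [idA idB eqI neqA neqB]]] : exists A B,
    [/\ is_ideal A, is_ideal B, I = A `&` B, I <> A & I <> B].
  apply: contrapT => noAB; apply: nirrI => A B idA idB eqI.
  apply: contrapT => /not_orP[neqA neqB]; apply: noAB.
  by exists A, B.
have IA : I `<=` A by rewrite eqI => x [].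
have IB : I `<=` B by rewrite eqI => x [].
have [r [D [prD eqA]]] := larger A idA IA neqA.
have [s [E [prE eqB]]] := larger B idB IB neqB.
exists (r + s)%N, (fun i => match split i with inl j => D j | inr j => E j end).
split; first by move=> i; case: (split i).
rewrite eqI eqA eqB; apply/seteqP; split=> [x [Dx Ex] i _|x DEx].
  by case: (split i) => j; [exact: Dx|exact: Ex].
split=> j _.
  by have := DEx (unsplit (inl j)) Logic.I; rewrite unsplitK.
by have := DEx (unsplit (inr j)) Logic.I; rewrite unsplitK.
Qed.

(** Take the least possible r: components with equal radicals could be merged, redundant ones
    dropped. *)
Lemma minimal_primary_decomposition_exists J : noetherian R -> is_ideal J ->
  exists r (D : 'I_r -> set R), minimal_primary_decomposition J D.
Proof.
move=> noeR idJ.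
pose L r := `[< exists D : 'I_r -> set R, primary_decomposition J D >].
have exL : exists r, L r.
  have [r [D DP]] := primary_decomposition_exists noeR idJ.
  by exists r; apply/asboolP; exists D.
case: (ex_minnP exL) => r /asboolP[D [prD eqJ]] minr.
exists r, D; split=> //.
- move=> i j /= eqrad; apply/eqP; apply: contrapT => /negP neqij.
  case: r D prD eqJ minr i j eqrad neqij => [|r] D prD eqJ minr i j; first by case: i.
  move=> eqrad neqij; suff /minr : L r by rewrite ltnn.
  apply/asboolP; exists (fun k =>
    if lift i k == j then D i `&` D j else D (lift i k)).
  split=> [k|].
    by case: ifP => // _; apply: (proj1 (primary_setI _ _ _)).
  rewrite eqJ; apply/seteqP; split=> x Dx k _.
    by case: ifP => _; [split|]; apply: Dx.
  have [j' eqj _] := unlift_some neqij.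
  have := Dx j' Logic.I; rewrite -eqj eqxx => -[Dix Djx].
  have [<-//|neqik] := eqVneq i k.
  have [k' eqk _] := unlift_some neqik; rewrite eqk.
  have := Dx k' Logic.I; case: ifP => [/eqP eqkj [] _|//].
  by rewrite eqkj.
move=> i subi.
case: r D prD eqJ minr i subi => [|r] D prD eqJ minr i; first by case: i.
move=> subi; suff /minr : L r by rewrite ltnn.
apply/asboolP; exists (fun k => D (lift i k)); split=> //.
rewrite eqJ; apply/seteqP; split=> x Dx k _; first exact: Dx.
have Dlt j : j != i -> D j x.
  by rewrite eq_sym => /unlift_some[j' -> _]; apply: Dx.
have [->|/Dlt//] := eqVneq k i.
by apply: subi => j; apply: Dlt.
Qed.

(** Otherwise pick in each D_i an element outside P; their product lies in every D_i but not in
    P. *)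
Lemma sub_prime_component P r (D : 'I_r -> set R) :
  prime_ideal P -> (forall i, is_ideal (D i)) -> \bigcap_i D i `<=` P ->
  exists i, D i `<=` P.
Proof.
move=> prP idD DP; apply: contrapT => noD.
have outside i : exists s, D i s /\ ~ P s.
  apply: contrapT => nos; apply: noD; exists i => s Ds.
  by apply: contrapT => nPs; apply: nos; exists s.
have [s sP] := choice outside.
apply: (primeN_prod prP (r := index_enum 'I_r) (C := xpredT) (F := s)) => [i _|].
  exact: (sP i).2.
apply: DP => i _; rewrite (bigD1 i) //=; apply: idealMr => //.
exact: (sP i).1.
Qed.

Lemma minimal_prime_component I P m r (D : 'I_r -> set R) : is_ideal I ->
  minimal_prime I P -> (0 < m)%N ->
  minimal_primary_decomposition (ideal_exp I m) D ->
  exists i, radical (D i) = P.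
Proof.
move=> idI [prP IP minP] m_gt0 [prD eqI _ _].
have [||i DiP] := @sub_prime_component P r D prP.
- by move=> i; case: (prD i).
- by rewrite -eqI => x /(ideal_exp_sub idI m_gt0)/IP.
exists i; apply: minP; first exact: radical_prime.
  move=> x Ix; exists m.
  have : ideal_exp I (1 * m) (x ^+ m) by apply: ideal_expX; apply: ideal_exp1.
  by rewrite mul1n eqI; apply.
by move=> x [l] /DiP; apply: primeX.
Qed.

(* The existence of primary decompositions is what makes the defining family of
   components nonempty at every minimal prime. *)
Lemma symbolic_powerP I m x : noetherian R -> is_ideal I ->
  symbolic_power I m x <-> forall P, minimal_prime I P -> loc P (ideal_exp I m) x.
Proof.
move=> noeR idI; split.
  case: m => [_ P [prP _ _]|m]; first exact: sub_loc.
  move=> Ix P minP; have [prP IP minP'] := minP.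
  have [r [D decD]] := minimal_primary_decomposition_exists noeR
    (ideal_exp_ideal I m.+1).
  have [i radDi] := minimal_prime_component idI minP (ltn0Sn m) decD.
  have Dx : D i x by apply: Ix; exists P => //; exists r, D, i.
  have [prD eqI injD _] := decD.
  (* Another component inside P would have a prime radical between I and P, hence the same radical P
     as D_i. The product of the s_j will multiply x into every component. *)
  have outside j : exists s, j != i -> D j s /\ ~ P s.
    have [->|neqji] := eqVneq j i; first by exists 0.
    apply: contrapT => nos; case/eqP: neqji; apply: injD.
    rewrite /= radDi; apply: minP'; first exact: radical_prime.
      move=> y Iy; exists m.+1.
      have : ideal_exp I (1 * m.+1) (y ^+ m.+1).
        by apply: ideal_expX; apply: ideal_exp1.
      by rewrite mul1n eqI; apply.
    move=> y [l Dyl]; apply: (@primeX _ _ prP _ l); apply: contrapT => nPy.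
    by apply: nos; exists (y ^+ l).
  have [s sP] := choice outside.
  exists (\prod_(j | j != i) s j).
    by apply: primeN_prod => // j /sP[].
  rewrite eqI => j _; have [->|neqji] := eqVneq j i.
    by apply: idealMl => //; case: (prD i).
  have [idDj _ _] := prD j; apply: idealMr => //.
  by rewrite (bigD1 j) //=; apply: idealMr => //; case: (sP j neqji).
case: m => [//|m] Ix Q [P minP [r [D [i [decD -> radDi]]]]].
have [s nPs] := Ix P minP.
have [prD -> _ _] := decD; move=> /(_ i Logic.I).
rewrite mulrC; have [_ _ prDi] := prD i => /prDi[//|].
by rewrite radDi.
Qed.

End PrimaryDecomposition.

(** * The Hilbert basis theorem *)

Section ChainTail.
Variables (T : Type) (C : nat -> set T).
Hypothesis CS : forall i, C i `<=` C i.+1.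

Lemma chain_le i j : (i <= j)%N -> C i `<=` C j.
Proof.
move=> /subnK <-; elim: (j - i)%N => [|d IHd] // x Cx.
by rewrite addSn; apply: CS; apply: IHd.
Qed.

End ChainTail.

Lemma noetherian_field (F : fieldType) : noetherian F.
Proof.
move=> I idI IS; have [[N [a [Ia a0]]]|no] :=
  pselect (exists N a, I N a /\ a != 0).
  exists N => i leNi; have full j : (N <= j)%N -> I j = setT.
    move=> leNj; apply/seteqP; split=> // x _.
    have -> : x = (x / a) * a by rewrite divfK.
    by apply: idealMl => //; apply: (chain_le IS leNj).
  by rewrite !full.
exists 0%N => i _; have triv j : I j = [set 0].
  apply/seteqP; split=> [x Ix|_ ->]; last exact: ideal0.
  by apply/eqP; apply: contrapT => /negP x0; apply: no; exists j, x.
by rewrite !triv.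
Qed.

Lemma noetherian_surj (A B : comNzRingType) (f : {rmorphism A -> B}) :
  (forall b, exists a, f a = b) -> noetherian A -> noetherian B.
Proof.
move=> fsurj noeA I idI IS.
have idf i : is_ideal (f @^-1` I i).
  split=> [|x y|a x] /=; rewrite ?rmorph0 ?rmorphD ?rmorphM.
  - exact: ideal0.
  - exact: idealD.
  - exact: idealMl.
have fS i : f @^-1` I i `<=` f @^-1` I i.+1 by move=> x; apply: IS.
have [N fN] := noeA _ idf fS.
exists N => i leNi; apply/seteqP; split=> b; have [a <-] := fsurj b => Ia.
  have : (f @^-1` I i) a by [].
  by rewrite fN.
by have : (f @^-1` I N) a by []; rewrite -(fN i).
Qed.

Section HilbertBasis.
Variable R : comNzRingType.
Implicit Types (I J : set {poly R}) (q : {poly R}) (d : nat).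

(** For an ideal I: 0 and the leading coefficients of its members of degree d. *)
Definition coef_ideal d I : set R :=
  [set a | exists q, [/\ I q, (size q <= d.+1)%N & q`_d = a]].

Lemma coef_ideal_ideal d I : is_ideal I -> is_ideal (coef_ideal d I).
Proof.
move=> idI; split.
- by exists 0; rewrite size_poly0 coef0; split=> //; apply: ideal0.
- move=> _ _ [q [Iq sq <-]] [r [Ir sr <-]]; exists (q + r); rewrite coefD.
  split=> //; first exact: idealD.
  by apply: leq_trans (size_polyD _ _) _; rewrite geq_max sq sr.
- move=> a _ [q [Iq sq <-]]; exists (a%:P * q); rewrite coefCM.
  split=> //; first exact: idealMl.
  by rewrite mul_polyC; apply: leq_trans (size_scale_leq _ _) sq.
Qed.

Lemma coef_idealS d I : is_ideal I -> coef_ideal d I `<=` coef_ideal d.+1 I.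
Proof.
move=> idI _ [q [Iq sq <-]]; exists (q * 'X); rewrite coefMX /=.
split=> //; first exact: idealMr.
by apply: leq_trans (size_polyMleq _ _) _; rewrite size_polyX addn2.
Qed.

Lemma coef_ideal_mono d I J : I `<=` J -> coef_ideal d I `<=` coef_ideal d J.
Proof. by move=> IJ _ [q [Iq sq <-]]; exists q; split=> //; apply: IJ. Qed.

(** Descent on the degree: subtracting a member of I with the same top coefficient leaves a member
    of J of lower degree. *)
Lemma coef_ideal_inj I J : is_ideal I -> is_ideal J -> I `<=` J ->
  (forall d, coef_ideal d I = coef_ideal d J) -> J = I.
Proof.
move=> idI idJ IJ eqc; apply/seteqP; split=> // q.
elim: (size q) {-2}q (leqnn (size q)) => [|d IHd] {}q.
  by rewrite leqn0 size_poly_eq0 => /eqP -> _; apply: ideal0.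
move=> sq Jq; have : coef_ideal d J q`_d by exists q.
rewrite -eqc => -[r [Ir sr eqr]].
rewrite -(subrK r q); apply: idealD => //; apply: IHd.
  apply/leq_sizeP => j; rewrite leq_eqVlt => /orP[/eqP <-|ltdj].
    by rewrite coefB eqr subrr.
  by rewrite coefB !nth_default ?subrr //; apply: leq_trans ltdj.
by apply: idealB => //; apply: IJ.
Qed.

(** The coefficient ideals increase in the degree d and in the index i. Their diagonal is constant
    from N on, which settles all d >= N; the finitely many d < N stabilise one by one. *)
Lemma noetherian_poly : noetherian R -> noetherian {poly R}.
Proof.
move=> noeR I idI IS.
have idc d i : is_ideal (coef_ideal d (I i)) by apply: coef_ideal_ideal.
have monoI d i j : (i <= j)%N -> coef_ideal d (I i) `<=` coef_ideal d (I j).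
  by move=> leij; apply: coef_ideal_mono; apply: chain_le.
have monod d e i : (d <= e)%N -> coef_ideal d (I i) `<=` coef_ideal e (I i).
  by apply: (chain_le (C := fun d => coef_ideal d (I i))) => d'; apply: coef_idealS.
have [N diagN] : exists N, forall i, (N <= i)%N ->
    coef_ideal i (I i) = coef_ideal N (I N).
  apply: (noeR (fun i => coef_ideal i (I i))) => // i x cx.
  by apply: (monod i) => //; apply: (monoI i i).
have stab d : exists M, forall i, (M <= i)%N ->
    coef_ideal d (I i) = coef_ideal d (I M).
  apply: (noeR (fun i => coef_ideal d (I i))) => // i.
  exact: monoI.
have [M MP] := choice stab.
pose L := maxn N (\max_(d < N) M d).
have leNL : (N <= L)%N by apply: leq_maxl.
exists L => i leLi; apply: coef_ideal_inj => // [|d]; first exact: chain_le.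
have [leNd|ltdN] := leqP N d.
  have big j : (N <= j)%N -> coef_ideal d (I j) = coef_ideal N (I N).
    move=> leNj; apply/seteqP; split=> x cx; last first.
      by apply: (monod N) => //; apply: (monoI N N).
    rewrite -(diagN (maxn d j)) ?leq_max ?leNd //.
    by apply: (monod d); rewrite ?leq_maxl //; apply: monoI cx; rewrite leq_maxr.
  by rewrite !big // (leq_trans leNL).
have leML : (M d <= L)%N.
  by rewrite leq_max (leq_bigmax (Ordinal ltdN)) orbT.
by rewrite (MP d L) // (MP d i) // (leq_trans leML).
Qed.

End HilbertBasis.

(** * Polynomial rings in finitely many variables *)

Lemma mpoly_ring_ind (k : comNzRingType) (n : nat) (Q : {mpoly k[n]} -> Prop) :
  (forall c, Q c%:MP) -> (forall i, Q 'X_i) ->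
  (forall f g, Q f -> Q g -> Q (f + g)) ->
  (forall f g, Q f -> Q g -> Q (f * g)) -> forall f, Q f.
Proof.
move=> QC QX QD QM f; rewrite [f]mpolyE; apply: (big_ind Q) => //.
  by rewrite -mpolyC0; apply: QC.
move=> m _; rewrite -mul_mpolyC; apply: (QM) => //; rewrite mpolyXE_id.
have Q1 : Q 1 by rewrite -mpolyC1; apply: QC.
apply: (big_ind Q) => // i _.
by elim: (m i) => [|e IHe] //; rewrite exprS; apply: QM.
Qed.

Lemma noetherian_mpoly (k : fieldType) (n : nat) : noetherian {mpoly k[n]}.
Proof.
elim: n => [|n IHn].
  apply: (@noetherian_surj _ _ (@mpolyC 0 k)); last exact: noetherian_field.
  apply: mpoly_ring_ind => [c|[]//|_ _ [a <-] [b <-]|_ _ [a <-] [b <-]].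
  - by exists c.
  - by exists (a + b); rewrite rmorphD.
  - by exists (a * b); rewrite rmorphM.
(* Sending the indeterminate to the last variable maps onto the ring in n + 1 variables. *)
pose phi : {rmorphism {poly {mpoly k[n]}} -> {mpoly k[n.+1]}} :=
  horner_eval ('X_ord_max : {mpoly k[n.+1]}) \o map_poly (@mwiden n k).
apply: (@noetherian_surj _ _ phi); last exact: noetherian_poly.
have phiC q : phi q%:P = mwiden q by rewrite /= map_polyC /horner_eval hornerC.
apply: mpoly_ring_ind => [c|i|_ _ [a <-] [b <-]|_ _ [a <-] [b <-]].
- by exists (c%:MP%:P); rewrite phiC mwidenC.
- have [->|neqi] := eqVneq i ord_max.
    by exists 'X; rewrite /= map_polyX /horner_eval hornerX.
  move: neqi; rewrite eq_sym => /unlift_some[j eqi _].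
  exists ('X_j)%:P; rewrite phiC mwidenX mnmwiden1 eqi.
  by congr 'X_[U_(_)]; apply: val_inj; rewrite /= /bump leqNgt ltn_ord.
- by exists (a + b); rewrite rmorphD.
- by exists (a * b); rewrite rmorphM.
Qed.

(** * Splittings of Frobenius on a polynomial ring *)

(* k is not assumed perfect or F-finite, so the functional comes from Zorn's
   lemma: W is a maximal k^p-subspace avoiding 1, and k = W + k^p. *)
Lemma pth_root_functional (k : fieldType) (p : nat) (charkp : p \in [pchar k]) :
  exists h : k -> k, [/\ {morph h : s t / s + t},
    forall r s, h (r ^+ p * s) = r * h s & h 1 = 1].
Proof.
have XD r s : (r + s) ^+ p = r ^+ p + s ^+ p :> k.
  by rewrite -!(pFrobenius_autE charkp) rmorphD.
have XN r : (- r) ^+ p = - (r ^+ p) :> k.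
  by rewrite -!(pFrobenius_autE charkp) rmorphN.
have p_gt0 : (0 < p)%N by rewrite prime_gt0 // (pcharf_prime charkp).
have X0 : 0 ^+ p = 0 :> k by rewrite expr0n gtn_eqF.
pose avoiding (W : set k) := [/\ ~ W 1, forall s t, W s -> W t -> W (s + t) &
  forall r s, W s -> W (r ^+ p * s)].
have [W [[nW1 WD WZ] maxW]] : exists W, avoiding W /\ forall B, W `<` B -> ~ avoiding B.
  apply: Zorn_bigcup => F Fav totF; split.
  - by case=> W /Fav[].
  - move=> s t [A FA As] [B FB Bt].
    have [AB|BA] := totF A B FA FB.
      by exists B => //; have [_ BD _] := Fav B FB; apply: BD => //; apply: AB.
    by exists A => //; have [_ AD _] := Fav A FA; apply: AD => //; apply: BA.
  - by move=> r s [A FA As]; exists A => //; have [_ _ AZ] := Fav A FA; apply: AZ.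
(* [avoiding] does not ask for 0, so that the empty union passes in Zorn's lemma; maximality
   supplies it. *)
have W0 : W 0.
  apply: contrapT => nW0; apply: (maxW (W `|` [set 0])).
    by split=> [x|/(_ 0)]; [left|move=> sub; apply: nW0; apply: sub; right].
  split=> [[//|/eqP]|s t|r s [Ws|->]]; last 2 first.
  - by left; apply: WZ.
  - by right; rewrite mulr0.
  - by rewrite oner_eq0.
  case=> [Ws|->]; case=> [Wt|->]; rewrite ?addr0 ?add0r; try by left.
    by left; apply: WD.
  by right.
have WN s : W s -> W (- s).
  by move=> /(WZ (-1)); rewrite XN expr1n mulN1r.
(* If s is outside W, maximality puts 1 in W + k^p s; solve for s. *)
have repr s : exists r, W (s - r ^+ p).
  have [Ws|nWs] := pselect (W s); first by exists 0; rewrite X0 subr0.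
  pose B := [set x | exists a r, W a /\ x = a + r ^+ p * s].
  have [a [r [Wa eq1]]] : B 1.
    apply: contrapT => nB1; apply: (maxW B).
      split=> [x Wx|sub]; first by exists x, 0; rewrite X0 mul0r addr0.
      by apply/nWs/sub; exists 0, 1; rewrite expr1n mul1r add0r.
    split=> // [_ _ [a [q [Wa ->]]] [b [r [Wb ->]]]|r _ [a [q [Wa ->]]]].
      by exists (a + b), (q + r); rewrite XD mulrDl addrACA; split=> //; apply: WD.
    by exists (r ^+ p * a), (r * q); rewrite exprMn mulrDr mulrA; split=> //; apply: WZ.
  have r0 : r != 0.
    by apply/eqP => r0; apply: nW1; rewrite eq1 r0 X0 mul0r addr0.
  exists r^-1; have -> : s - r^-1 ^+ p = - (r^-1 ^+ p * a).
    have -> : a = 1 - r ^+ p * s by rewrite {1}eq1 addrK.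
    by rewrite mulrBr mulr1 mulrA -exprMn mulVf // expr1n mul1r opprB.
  by apply: WN; apply: WZ.
(* The p-th power of r - s lies in W; were it nonzero, scaling would put 1 in W. *)
have uniq r s t : W (t - r ^+ p) -> W (t - s ^+ p) -> r = s.
  move=> Wr Ws; apply/eqP; rewrite -subr_eq0; apply: contrapT => /negP nz.
  apply: nW1; have : W ((r - s) ^+ p).
    by have := WD _ _ Ws (WN _ Wr); rewrite XD XN opprB addrC subrKA.
  by move=> /(WZ (r - s)^-1); rewrite -exprMn mulVf // expr1n.
have [h hP] := choice repr; exists h; split.
- move=> s t; apply: (uniq _ _ (s + t)) => //.
  by rewrite XD opprD addrACA; apply: WD.
- move=> r s; apply: (uniq _ _ (r ^+ p * s)) => //.
  by rewrite exprMn -mulrBr; apply: WZ.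
- by apply: (uniq _ _ 1) => //; rewrite expr1n subrr.
Qed.

Section FrobeniusTrace.
Variables (k : fieldType) (n p : nat) (charkp : p \in [pchar k]).
Local Notation S := {mpoly k[n]}.
Implicit Types (a f : S) (m u v : 'X_{1..n}).

Definition top_exponent m : 'X_{1..n} := [multinom (m i * p + p.-1)%N | i < n].

Let p_gt0 : (0 < p)%N.
Proof. by rewrite prime_gt0 // (pcharf_prime charkp). Qed.

Lemma top_exponent0 : top_exponent 0 = [multinom p.-1 | i < n].
Proof. by apply/mnmP => i; rewrite !mnmE mul0n. Qed.

Lemma mdeg_top_exponent m :
  mdeg (top_exponent m) = (mdeg m * p + mdeg (top_exponent 0))%N.
Proof.
rewrite top_exponent0 !mdegE big_distrl /= -big_split /=.
by apply: eq_bigr => i _; rewrite !mnmE.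
Qed.

Section Trace.
Variable h : k -> k.
Hypotheses (hD : {morph h : s t / s + t})
  (hZ : forall r s, h (r ^+ p * s) = r * h s).

Let h0 : h 0 = 0.
Proof. by rewrite -[0 in LHS](mulr0 (0 ^+ p)) hZ mul0r. Qed.

(** The Frobenius trace: c x^(pm + p-1), with p-1 added in each coordinate, goes to h(c) x^m, and
    monomials of other shapes to 0. The range suffices because [top_exponent m] has at least the
    degree of m. *)
Definition trace a : S :=
  \sum_(m : 'X_{1..n < msize a}) h a@_(top_exponent m) *: 'X_[m].

Lemma mcoeff_trace a m : (trace a)@_m = h a@_(top_exponent m).
Proof.
rewrite /trace raddf_sum /=.
under eq_bigr do rewrite mcoeffZ mcoeffX.
have [ltm|gem] := ltnP (mdeg m) (msize a).
  rewrite (bigD1 (BMultinom ltm)) //= eqxx mulr1 big1 ?addr0 // => m' neq.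
  by case: eqP => [eqm|]; rewrite ?mulr0 //; case/eqP: neq; apply: val_inj.
rewrite big1 => [|m' _].
  rewrite memN_msupp_eq0 // msize_mdeg_ge //.
  rewrite (leq_trans gem) // mdeg_top_exponent.
  by rewrite (leq_trans (leq_pmulr _ p_gt0)) ?leq_addr.
by case: eqP => [eqm|]; rewrite ?mulr0 //; have := bmdeg m'; rewrite eqm ltnNge gem.
Qed.

Lemma traceD : {morph trace : a b / a + b}.
Proof. by move=> a b; apply/mpolyP => m; rewrite mcoeffD !mcoeff_trace mcoeffD hD. Qed.

Lemma mcoeffXM0 a u m : ~~ (u <= m)%MM -> ('X_[u] * a)@_m = 0.
Proof.
move=> nle; apply: memN_msupp_eq0; apply: contra nle.
move/msuppM_le => /allpairsP[[u' v] /= []].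
by rewrite msuppX inE => /eqP -> _ ->; apply: lem_addr.
Qed.

(** By ring induction on r it suffices to treat constants and variables; x_i^p shifts [top_exponent]
    by one step in coordinate i. *)
Lemma trace_scale r a : trace (r ^+ p * a) = r * trace a.
Proof.
have charS : p \in [pchar S] by apply: (rmorph_pchar (@mpolyC n k)).
elim/mpoly_ring_ind: r a => [c|i|f g IHf IHg|f g IHf IHg] a.
- apply/mpolyP => m.
  by rewrite mcoeff_trace -rmorphXn /= !mcoeffCM hZ mcoeff_trace.
- apply/mpolyP => m; rewrite mcoeff_trace mpolyXn.
  have [le1|nle1] := boolP (U_(i) <= m)%MM.
    rewrite -(submK le1) addmC; set m' := (m - _)%MM.
    have -> : top_exponent (U_(i) + m') = (U_(i) *+ p + top_exponent m')%MM.
      by apply/mnmP => j; rewrite !(mnmE, mulmnE) mulnDl addnA.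
    by rewrite ![_ * a]mulrC ![_ * trace a]mulrC !mcoeffMX mcoeff_trace.
  (* If x_i does not divide m, the i-th entry of [top_exponent m] is p-1 < p, and both sides
     vanish. *)
  rewrite !mcoeffXM0 //; apply: contra nle1 => /mnm_lepP le1.
  apply/mnm_lepP => j; rewrite mnm1E; case: eqP => // eqij; rewrite lt0n.
  have := le1 j; rewrite mulmnE mnm1E mnmE eqij eqxx mul1n.
  by case: (m j) => //; rewrite mul0n add0n -{1}(prednK p_gt0) ltnn.
- have -> : (f + g) ^+ p = f ^+ p + g ^+ p.
    by rewrite -!(pFrobenius_autE charS) rmorphD.
  by rewrite !mulrDl traceD IHf IHg.
- by rewrite exprMn -!mulrA IHf IHg.
Qed.

End Trace.

Definition weight (w : 'I_n -> nat) m := (\sum_i w i * m i)%N.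

Lemma weightD w m m' : weight w (m + m') = (weight w m + weight w m')%N.
Proof. by rewrite -big_split; apply: eq_bigr => i _; rewrite mnmDE mulnDr. Qed.

(** Weights need not separate monomials, so u must beat all others strictly; homogeneity will single
    out one term of the trace. *)
Definition monic_lead (w : 'I_n -> nat) f u : Prop :=
  f@_u = 1 /\ forall m, m \in msupp f ->
    mdeg m = mdeg u /\ (m <> u -> (weight w m < weight w u)%N).

Lemma monic_leadX w u : monic_lead w 'X_[u] u.
Proof.
split; first by rewrite mcoeffX eqxx.
by move=> m; rewrite msuppX inE => /eqP ->.
Qed.

Lemma monic_lead_binomial w u v : mdeg v = mdeg u ->
  (weight w v < weight w u)%N -> monic_lead w ('X_[u] - 'X_[v]) u.
Proof.
move=> degv ltvu; have nvu : (v == u) = false.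
  by apply/eqP => eqvu; rewrite eqvu ltnn in ltvu.
split; first by rewrite mcoeffB !mcoeffX eqxx nvu subr0.
move=> m /msuppB_le; rewrite !msuppX !inE => /orP[]/eqP -> //.
Qed.

Lemma weightU w i : weight w U_(i) = w i.
Proof.
rewrite /weight (bigD1 i) //= mnm1E eqxx muln1 big1 ?addn0 // => j neq.
by rewrite mnm1E eq_sym (negPf neq) muln0.
Qed.

Lemma monic_leadM w f g u v : monic_lead w f u -> monic_lead w g v ->
  monic_lead w (f * g) (u + v).
Proof.
move=> [fu fP] [gv gP]; split.
  (* Monomials of f - X^u weigh less than u, so their products with monomials of g never reach u +
     v. *)
  rewrite -(subrK 'X_[u] f) mulrDl mcoeffD ['X_[u] * g]mulrC mcoeffMX gv.
  rewrite memN_msupp_eq0 ?add0r //; apply/negP.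
  move/msuppM_le/allpairsP => [[m1 m2] /= [m1f m2g eqm]].
  have neq1 : m1 <> u.
    move=> eq1; move: m1f; rewrite eq1 mcoeff_msupp mcoeffB fu mcoeffX eqxx.
    by rewrite subrr eqxx.
  have m1f' : m1 \in msupp f.
    move: m1f; rewrite !mcoeff_msupp mcoeffB mcoeffX.
    by case: (eqVneq u m1) => [/esym//|_]; rewrite subr0.
  have lt1 := (fP _ m1f').2 neq1.
  have le2 : (weight w m2 <= weight w v)%N.
    by have [->//|/eqP/(gP _ m2g).2/ltnW] := eqVneq m2 v.
  have := congr1 (weight w) eqm; rewrite !weightD => /eqP.
  by rewrite gtn_eqF // -addSn leq_add.
move=> _ /msuppM_le/allpairsP [[m1 m2] /= [/fP[deg1 lt1] /gP[deg2 lt2] ->]].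
rewrite !mdegD deg1 deg2 !weightD; split=> // neq.
have [eq1|/eqP/lt1 {}lt1] := eqVneq m1 u.
  by rewrite eq1 ltn_add2l; apply: lt2 => eq2; apply: neq; rewrite eq1 eq2.
rewrite -addSn leq_add //.
by have [->//|/eqP/lt2/ltnW] := eqVneq m2 v.
Qed.

Lemma monic_lead1 w : monic_lead w 1 0.
Proof. by rewrite -mpolyX0; apply: monic_leadX. Qed.

Lemma monic_leadXn w f u e : monic_lead w f u -> monic_lead w (f ^+ e) (u *+ e).
Proof.
move=> fu; elim: e => [|e IHe]; first by rewrite expr0 mulm0n; apply: monic_lead1.
by rewrite exprS mulmS; apply: monic_leadM.
Qed.

Lemma monic_lead_prod (T : Type) (r : seq T) (F : T -> S) (e : T -> 'X_{1..n}) w :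
  (forall i, monic_lead w (F i) (e i)) ->
  monic_lead w (\prod_(i <- r) F i) (\sum_(i <- r) e i)%MM.
Proof.
move=> FP; apply: (big_ind2 (monic_lead w)) => //; first exact: monic_lead1.
by move=> f u g v; apply: monic_leadM.
Qed.

(* f^(p-1) is homogeneous of the degree of the monomial (x_1...x_n)^(p-1), so
   that monomial, with coefficient 1, is the only one contributing to the trace. *)
Lemma frobenius_splitting w f : monic_lead w f [multinom 1%N | i < n] ->
  exists h : S -> S, [/\ {morph h : a b / a + b},
    forall r a, h (r ^+ p * a) = r * h a & h (f ^+ p.-1) = 1].
Proof.
move=> lead_f; have [h [hD hZ h1]] := pth_root_functional charkp.
exists (trace h); split; [exact: traceD|exact: trace_scale|].
have [] := monic_leadXn p.-1 lead_f.
have -> : ([multinom 1%N | i < n] *+ p.-1)%MM = top_exponent 0.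
  by rewrite top_exponent0; apply/mnmP => i; rewrite mulmnE !mnmE mul1n.
move=> coef1 degs; apply/mpolyP => m; rewrite mcoeff_trace // mcoeff1.
have [->|m0] := eqVneq m 0%MM; first by rewrite coef1.
rewrite memN_msupp_eq0; first by rewrite -(mulr0 (0 ^+ p)) hZ mul0r.
apply/negP => /degs[+ _]; rewrite mdeg_top_exponent => /eqP.
by rewrite -[X in _ == X]add0n eqn_add2r muln_eq0 mdeg_eq0 (negPf m0) gtn_eqF.
Qed.

End FrobeniusTrace.

(** * A local criterion for symbolic F-splitting *)

Section FrobeniusPower.
Variables (R : comNzRingType) (p : nat).
Hypothesis p_gt0 : (0 < p)%N.
Implicit Types (A B J P : set R) (f x : R) (m n : nat).

Definition frobenius_power B : set R := ideal_gen [set z | exists2 b, B b & z = b ^+ p].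

Lemma ideal_exp_monomials (I : finType) (g : I -> R) m :
  ideal_exp (ideal_gen (range g)) m `<=`
  ideal_gen [set z | exists2 e : I -> nat, \sum_i e i = m & z = \prod_i g i ^+ e i].
Proof.
elim: m => [|m IHm].
  move=> x _; rewrite -[x]mulr1; apply: (idealMl _ (ideal_gen_ideal _)).
  apply: sub_ideal_gen; exists (fun=> 0%N); first by rewrite big1.
  by rewrite big1.
set X := [set z | _]; have idX := ideal_gen_ideal X.
(* A colon ideal, hence to be tested only on the generators g_i. *)
pose X' := [set a | forall b, ideal_exp (ideal_gen (range g)) m b -> ideal_gen X (a * b)].
have idX' : is_ideal X'.
  split=> [b _|a b Xa Xb c Ic|a b Xb c Ic].
  - by rewrite mul0r; apply: (ideal0 idX).
  - by rewrite mulrDl; apply: (idealD idX); [apply: Xa|apply: Xb].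
  - by rewrite -mulrA; apply: (idealMl _ idX); apply: Xb.
suff : ideal_gen (range g) `<=` X' by move=> sub; apply: ideal_mul_min => // a b /sub; apply.
apply: ideal_gen_min => // _ [i _ <-] b /IHm; move: b.
apply: ideal_gen_min.
  split=> [|a b|a b] /=; rewrite ?mulr0 ?mulrDr ?[g i * (a * b)]mulrCA.
  - exact: ideal0 idX.
  - exact: idealD idX.
  - exact: idealMl idX.
move=> _ [e sum_e ->]; apply: sub_ideal_gen.
exists (fun j => (j == i) + e j)%N.
  by rewrite big_split /= sum_e -big_mkcond /= sum1_card card1.
under [RHS]eq_bigr do rewrite exprD.
rewrite big_split /=; congr (_ * _).
by rewrite (bigD1 i) //= eqxx expr1 big1 ?mulr1 // => j /negPf ->.
Qed.

(* Pigeonhole: a monomial of degree |I|(p-1) + np + 1 in the g_i is divisible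
   by the p-th power of one of degree n + 1. *)
Lemma ideal_exp_frobenius (I : finType) (g : I -> R) n :
  ideal_exp (ideal_gen (range g)) (#|I| * p.-1 + (n * p).+1) `<=`
  frobenius_power (ideal_exp (ideal_gen (range g)) n.+1).
Proof.
move=> x /ideal_exp_monomials; move: x; apply: ideal_gen_min.
  exact: ideal_gen_ideal.
move=> _ [e sum_e ->].
(* Divide each exponent by p with remainder. *)
have -> : \prod_i g i ^+ e i =
    (\prod_i g i ^+ (e i %% p)) * (\prod_i g i ^+ (e i %/ p)) ^+ p.
  rewrite -prodrXl -big_split /=; apply: eq_bigr => i _.
  by rewrite -exprM -exprD addnC -divn_eq.
apply: (idealMl _ (ideal_gen_ideal _)).
apply: sub_ideal_gen; exists (\prod_i g i ^+ (e i %/ p)) => //.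
apply: (@ideal_exp_le _ _ _ (\sum_i e i %/ p)%N); last first.
  apply: ideal_exp_prod => i _; rewrite -[X in ideal_exp _ X]mul1n.
  by apply: ideal_expX; apply: ideal_exp1; apply: sub_ideal_gen; exists i.
rewrite ltnNge; apply/negP => le_n.
have : (\sum_i e i <= n * p + #|I| * p.-1)%N.
  apply: leq_trans (leq_add (leq_mul le_n (leqnn p)) (leqnn _)).
  rewrite -sum_nat_const big_distrl -big_split /=; apply: leq_sum => i _.
  by rewrite {1}(divn_eq (e i) p) leq_add2l -ltnS prednK // ltn_mod.
by rewrite sum_e addnC addSn ltnn.
Qed.

Variable h : R -> R.
Hypotheses (hD : {morph h : a b / a + b})
  (hZ : forall r a, h (r ^+ p * a) = r * h a).

(** Since h is only p^-1-linear, the condition is strengthened to all multiples of x, which makes it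
    define an ideal. *)
Lemma trace_frobenius_power B x : is_ideal B -> frobenius_power B x -> B (h x).
Proof.
move=> idB; have h0 : h 0 = 0 by rewrite -[0 in LHS](mulr0 (0 ^+ p)) hZ mul0r.
suff sub : frobenius_power B `<=` [set x | forall a, B (h (a * x))].
  by move=> /sub/(_ 1); rewrite mul1r.
apply: ideal_gen_min.
  split=> [a|y z By Bz a|y z Bz a] /=.
  - by rewrite mulr0 h0; apply: ideal0.
  - by rewrite mulrDr hD; apply: idealD; [|apply: By|apply: Bz].
  - by rewrite mulrA; apply: Bz.
by move=> _ [b Bb ->] a /=; rewrite mulrC hZ; apply: idealMr.
Qed.

(** At P the g_i generate J, so orders are counted in them: |I|(p-1) from f^(p-1) and np + 1 from x,
    as the pigeonhole bound asks. *)
Lemma trace_loc P J f (I : finType) (g : I -> R) n x :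
  prime_ideal P -> is_ideal J ->
  (forall i, loc P J (g i)) -> J `<=` loc P (ideal_gen (range g)) ->
  loc P (ideal_exp (ideal_gen (range g)) #|I|) f ->
  loc P (ideal_exp J (n * p).+1) x ->
  loc P (ideal_exp J n.+1) (h (f ^+ p.-1 * x)).
Proof.
move=> prP idJ locg locJ locf.
move/(loc_exp_sub prP locJ) => locx.
have [s nPs] := loc_expM prP (loc_expX prP p.-1 locf) locx.
move/ideal_exp_frobenius; set y := f ^+ p.-1 * x => frob.
apply: (locP prP nPs).
suff : ideal_exp (ideal_gen (range g)) n.+1 (s * h y).
  move/(sub_loc prP); apply: loc_exp_sub => //.
  apply: ideal_gen_min; first exact: loc_ideal.
  by move=> _ [i _ <-].
(* The denominator s enters h as s^p; one of its factors brings y into the Frobenius power. *)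
rewrite -hZ; apply: trace_frobenius_power; first exact: ideal_exp_ideal.
rewrite -(prednK p_gt0) exprSr -mulrA.
exact: (idealMl _ (ideal_gen_ideal _)).
Qed.

End FrobeniusPower.

(** * The splitting twisted by f *)

Section Criterion.
Variables (R : comNzRingType) (p : nat) (charRp : p \in [pchar R]).
Variables (f : R) (h : R -> R).
Hypotheses (hD : {morph h : a b / a + b})
  (hZ : forall r a, h (r ^+ p * a) = r * h a) (h1 : h (f ^+ p.-1) = 1).

Definition twisted_trace (a : pth_root_ring charRp) : R^o := h (f ^+ p.-1 * (a : R)).

Fact twisted_trace_linear : linear twisted_trace.
Proof.
move=> r a b; rewrite /twisted_trace pth_scaleE /pth_incl pFrobenius_autE.
by rewrite mulrDr hD mulrCA hZ.
Qed.

HB.instance Definition _ :=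
  GRing.isLinear.Build R (pth_root_ring charRp) R^o *:%R twisted_trace
    twisted_trace_linear.

(** Membership in a symbolic power is tested at the minimal primes; at each of them f has to lie in
    the power of J whose exponent is the number of local generators. *)
Lemma symbolic_F_split_local (J : set R) : noetherian R -> is_ideal J ->
  (forall P, minimal_prime J P -> exists (I : finType) (g : I -> R),
    [/\ forall i, loc P J (g i), J `<=` loc P (ideal_gen (range g)) &
        loc P (ideal_exp (ideal_gen (range g)) #|I|) f]) ->
  symbolic_F_split charRp J.
Proof.
move=> noeR idJ locJ; have p_gt0 : (0 < p)%N.
  by rewrite prime_gt0 // (pcharf_prime charRp).
have symP m x := symbolic_powerP m x noeR idJ.
have idS m : is_ideal (symbolic_power J m).
  case: m => [|m]; first exact: ideal_setT.
  apply: ideal_bigcap => Q [P _ [r [D [i [[prD _ _ _] -> _]]]]].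
  by case: (prD i).
split=> // [m x /symP Jx|m n|].
- apply/symP => P minP; have [prP _ _] := minP.
  by move: (Jx P minP); apply: loc_mono; apply: ideal_expS_sub.
- apply: ideal_mul_min => // x y /symP Jx /symP Jy.
  apply/symP => P minP; have [prP _ _] := minP.
  by apply: loc_expM => //; [apply: Jx|apply: Jy].
exists twisted_trace; split=> [r|n].
  by rewrite /= /twisted_trace /pth_incl pFrobenius_autE mulrC hZ h1 mulr1.
move=> _ [_ [x /symP Jx <-] <-]; apply/symP => P minP.
have [prP _ _] := minP; have [I [g [locg Jg fg]]] := locJ P minP.
by apply: (trace_loc p_gt0 hD hZ prP idJ locg Jg fg); apply: Jx.
Qed.

End Criterion.

(** * Minimal primes of binomial edge ideals *)

Section PolyPrime.
Variable R : comNzRingType.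
Implicit Types (P : set R) (q r : {poly R}).

Definition poly_ideal P : set {poly R} := [set q | forall i, P q`_i].

Lemma poly_ideal_ideal P : is_ideal P -> is_ideal (poly_ideal P).
Proof.
move=> idP; split=> [i|q r Pq Pr i|a q Pq i].
- by rewrite coef0; apply: (ideal0 idP).
- by rewrite coefD; apply: (idealD idP); [apply: Pq|apply: Pr].
- by rewrite coefM; apply: (ideal_sum _ idP) => j _; apply: idealMl idP _.
Qed.

Lemma poly_idealC P a : is_ideal P -> P a -> poly_ideal P a%:P.
Proof. by move=> idP Pa i; rewrite coefC; case: eqP => // _; apply: ideal0. Qed.

(** Gauss's argument: if q_i and r_j are the first coefficients outside P, the coefficient of qr at
    i + j is q_i r_j modulo P. *)
Lemma poly_ideal_prime P : prime_ideal P -> prime_ideal (poly_ideal P).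
Proof.
move=> prP; have [idP nP1 prM] := prP; split; first exact: poly_ideal_ideal.
  by move=> /(_ 0%N); rewrite coefC.
move=> q r Pqr; apply: contrapT => /not_orP[nPq nPr].
have least (s : {poly R}) : ~ poly_ideal P s ->
    exists2 i, ~ P s`_i & forall j, (j < i)%N -> P s`_j.
  move=> /existsNP[i nPi].
  have ex : exists i, `[< ~ P s`_i >] by exists i; apply/asboolP.
  case: (ex_minnP ex) => m /asboolP nPm minm; exists m => // j ltjm.
  by apply: contrapT => /asboolP/minm; rewrite leqNgt ltjm.
have [i nPi Pi] := least q nPq; have [j nPj Pj] := least r nPr.
apply: (primeNM prP nPi nPj).
have lti : (i < (i + j).+1)%N by rewrite ltnS leq_addr.
have := Pqr (i + j)%N; rewrite coefM (bigD1 (Ordinal lti)) //= addKn.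
apply: (idealDl idP); apply: (ideal_sum _ idP) => l neq.
have [ltl|] := ltnP l i; first by apply: (idealMr _ idP); apply: Pi.
rewrite leq_eqVlt => /orP[/eqP eqil|ltl].
  by case/eqP: neq; apply: val_inj.
apply: (idealMl _ idP); apply: Pj.
by rewrite ltn_subLR ?ltn_add2r // -ltnS.
Qed.

End PolyPrime.

Lemma preimage_prime (A B : comNzRingType) (f : {rmorphism A -> B}) (P : set B) :
  prime_ideal P -> prime_ideal (f @^-1` P).
Proof.
move=> [idP nP1 prM]; split.
- split=> [|x y|a x] /=; rewrite ?rmorph0 ?rmorphD ?rmorphM.
  + exact: ideal0.
  + exact: idealD.
  + exact: idealMl.
- by rewrite /= rmorph1.
- by move=> x y /=; rewrite rmorphM => /prM.
Qed.

Section EdgeIdeal.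
Variables (k : fieldType) (n : nat) (G : graph 'I_n).
Local Notation S := {mpoly k[n + n]}.
Local Notation x := (@xvar k n).
Local Notation y := (@yvar k n).
Local Notation f := (@edge_binomial k n).
Local Notation J := (binomial_edge_ideal k G).
Implicit Types (P I : set S) (a b t : 'I_n).

Lemma edge_ideal_ideal : is_ideal J.
Proof. exact: ideal_gen_ideal. Qed.

Lemma edge_ideal_edge a b : G a b -> J (f a b).
Proof. by move=> Gab; apply: sub_ideal_gen; exists a, b. Qed.

Lemma edge_binomial_opp a b : f a b = - f b a.
Proof. by rewrite /edge_binomial; ring. Qed.

Section DeformVertex.
Variables (t : 'I_n) (al be : S).

Definition deform_var (i : 'I_(n + n)) : {poly S} :=
  match split i with
  | inl a => if a == t then al%:P * 'X else (x a)%:P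
  | inr a => if a == t then be%:P * 'X else (y a)%:P
  end.

Definition deform : {rmorphism S -> {poly S}} :=
  mmap (polyC \o @mpolyC (n + n) k) deform_var.

Lemma deform_x a : deform (x a) = if a == t then al%:P * 'X else (x a)%:P.
Proof.
by rewrite /deform /= mmapX mmap1U /deform_var -[lshift n a]/(unsplit (inl a)) unsplitK.
Qed.

Lemma deform_y a : deform (y a) = if a == t then be%:P * 'X else (y a)%:P.
Proof.
by rewrite /deform /= mmapX mmap1U /deform_var -[rshift n a]/(unsplit (inr a)) unsplitK.
Qed.

Lemma deformD g h : deform (g + h) = deform g + deform h.
Proof. exact: rmorphD. Qed.

Lemma deformM g h : deform (g * h) = deform g * deform h.
Proof. exact: rmorphM. Qed.

(** The constant coefficient replaces x_t and y_t by 0, which changes nothing modulo P. *)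
Lemma deform0 P g : is_ideal P -> P (x t) -> P (y t) -> P (g - (deform g)`_0).
Proof.
move=> idP Pxt Pyt; elim/mpoly_ring_ind: g => [c|i|g h Pg Ph|g h Pg Ph].
- by rewrite /deform /= mmapC coefC subrr; apply: ideal0.
- rewrite -(splitK i); case: (split i) => a /=.
    rewrite -/(x a) deform_x; case: eqP => [->|_].
      by rewrite coefMX subr0.
    by rewrite coefC subrr; apply: ideal0.
  rewrite -/(y a) deform_y; case: eqP => [->|_].
    by rewrite coefMX subr0.
  by rewrite coefC subrr; apply: ideal0.
- by rewrite deformD coefD opprD addrACA; exact: idealD idP Pg Ph.
- rewrite deformM coef0M; exact: idealBM idP Pg Ph.
Qed.

End DeformVertex.

(* If (al, be) is compatible with all the edges at t, then replacing (x_t, y_t) by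
   a generic multiple z(al, be) pulls P[z] back to a prime between J and P; by
   minimality it is P, and it contains x_t and y_t only if P contains al and be. *)
Lemma minimal_prime_vertex P t al be : minimal_prime J P -> P (x t) -> P (y t) ->
  (forall b, G t b -> P (al * y b - be * x b)) -> P al /\ P be.
Proof.
move=> [prP JP minP] Pxt Pyt nbr; have [idP _ _] := prP.
have idPz := poly_ideal_ideal idP.
pose Q := deform t al be @^-1` poly_ideal P.
have QP : Q = P.
  apply: minP; first by apply: preimage_prime; apply: poly_ideal_prime.
    apply: ideal_gen_min.
      by case: (preimage_prime (deform t al be) (poly_ideal_prime prP)).
    move=> _ [a [b [Gab ->]]]; rewrite /Q /= rmorphB !rmorphM !deform_x !deform_y.
    have Pab : P (f a b) by apply: JP; apply: edge_ideal_edge.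
    case: eqP => [eqa|_]; case: eqP => [eqb|_].
    - by move: Gab; rewrite eqa eqb adj_irr.
    - have -> : al%:P * 'X * (y b)%:P - be%:P * 'X * (x b)%:P =
        'X * (al * y b - be * x b)%:P by rewrite !(rmorphB, rmorphM) /=; ring.
      by apply: (idealMl _ idPz); apply: poly_idealC => //; apply: nbr; rewrite -eqa.
    - have -> : (x a)%:P * (be%:P * 'X) - (y a)%:P * (al%:P * 'X) =
        - 'X * (al * y a - be * x a)%:P by rewrite !(rmorphB, rmorphM) /=; ring.
      apply: (idealMl _ idPz); apply: poly_idealC => //.
      by apply: nbr; rewrite -eqb adj_sym.
    - by rewrite -!rmorphM -rmorphB; apply: poly_idealC.
  move=> g Qg; rewrite -(subrK (deform t al be g)`_0 g).
  by apply: (idealD idP); [apply: deform0|apply: Qg].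
have Qx : Q (x t) by rewrite QP.
have Qy : Q (y t) by rewrite QP.
move: Qx; rewrite /Q /= deform_x eqxx => /(_ 1%N); rewrite coefMX coefC /= => Pal.
move: Qy; rewrite /Q /= deform_y eqxx => /(_ 1%N); rewrite coefMX coefC /= => Pbe.
exact: conj Pal Pbe.
Qed.

(** Were all neighbours of t proportional modulo P, each (x_a, y_a) could serve as (al, be) and so
    would lie in P; then (1, 0) is compatible too, and 1 would lie in P. *)
Lemma minimal_prime_cut P t : minimal_prime J P -> P (x t) -> P (y t) ->
  exists a b, [/\ G t a, G t b & ~ P (f a b)].
Proof.
move=> minP Pxt Pyt; have [prP _ _] := minP; have [idP nP1 _] := prP.
apply: contrapT => nocut.
have nbrP a b : G t a -> G t b -> P (f a b).
  by move=> Gta Gtb; apply: contrapT => nPab; apply: nocut; exists a, b.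
have nbr0 a : G t a -> P (x a) /\ P (y a).
  move=> Gta; apply: minimal_prime_vertex minP Pxt Pyt _ => b Gtb.
  by have := nbrP a b Gta Gtb.
have vertical b : G t b -> P (1 * y b - 0 * x b).
  by move=> /nbr0[_ Pyb]; rewrite mul1r mul0r subr0.
by have [] := minimal_prime_vertex minP Pxt Pyt vertical.
Qed.

(** Cramer's rule: f_ab x_t and f_ab y_t are combinations of f_ta and f_tb, and f_ab is a unit at P
    for suitable neighbours a, b. *)
Lemma minimal_prime_vertex_loc P t : minimal_prime J P -> P (x t) -> P (y t) ->
  loc P J (x t) /\ loc P J (y t).
Proof.
move=> minP Pxt Pyt; have [a [b [Gta Gtb nPab]]] := minimal_prime_cut minP Pxt Pyt.
have idJ := edge_ideal_ideal.
have Ja := edge_ideal_edge Gta; have Jb := edge_ideal_edge Gtb.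
split; exists (f a b) => //.
  have -> : f a b * x t = x a * f t b - x b * f t a by rewrite /edge_binomial; ring.
  by apply: (idealB idJ); apply: (idealMl _ idJ).
have -> : f a b * y t = y a * f t b - y b * f t a by rewrite /edge_binomial; ring.
by apply: (idealB idJ); apply: (idealMl _ idJ).
Qed.

Definition simplicial c := forall a b, G c a -> G c b -> a != b -> G a b.

Lemma minimal_prime_simplicial P c : minimal_prime J P -> simplicial c ->
  ~ (P (x c) /\ P (y c)).
Proof.
move=> minP simp [Pxc Pyc].
have [a [b [Gca Gcb]]] := minimal_prime_cut minP Pxc Pyc; apply.
have [prP JP _] := minP; have [idP _ _] := prP.
have [->|neqab] := eqVneq a b.
  by rewrite /edge_binomial mulrC subrr; apply: ideal0.
by apply: JP; apply: edge_ideal_edge; apply: simp.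
Qed.

(* Where (x_a, y_a) is not zero, proportionality to it is transitive. *)
Lemma loc_edge_trans P I a b c : prime_ideal P -> is_ideal I ->
  ~ (P (x a) /\ P (y a)) -> loc P I (f a b) -> loc P I (f a c) -> loc P I (f b c).
Proof.
move=> prP idI nPa Iab Iac; have idL := loc_ideal prP idI.
have [Pxa|nPxa] := pselect (P (x a)).
  have nPya : ~ P (y a) by move=> Pya; apply: nPa.
  apply: (locP prP nPya).
  have -> : y a * f b c = y b * f a c - y c * f a b by rewrite /edge_binomial; ring.
  by apply: (idealB idL); apply: (idealMl _ idL).
apply: (locP prP nPxa).
have -> : x a * f b c = x b * f a c - x c * f a b by rewrite /edge_binomial; ring.
by apply: (idealB idL); apply: (idealMl _ idL).
Qed.

(** * The path product at a minimal prime *)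

Section VertexOrder.
Variables (w : nat -> 'I_n) (m : nat).
Hypothesis w_surj : forall a, exists2 i, (i <= m)%N & w i = a.
Hypothesis w_edge : forall i c j, (i < c)%N -> (c < j)%N -> (j <= m)%N ->
  G (w i) (w j) -> G (w i) (w c) /\ simplicial (w c).

Definition path_product : S :=
  y (w 0) * (\prod_(i < m) f (w i) (w i.+1)) * x (w m).

Lemma path_product_local P : minimal_prime J P ->
  exists (I : finType) (g : I -> S),
    [/\ forall i, loc P J (g i), J `<=` loc P (ideal_gen (range g)) &
        loc P (ideal_exp (ideal_gen (range g)) #|I|) path_product].
Proof.
move=> minP; have [prP JP _] := minP; have [idP _ _] := prP.
(* [T] marks the vertices with both variables in P; [E] marks the steps between unmarked vertices
   whose binomial lies in J at P. *)
pose T i := `[< P (x (w i)) /\ P (y (w i)) >].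
pose E i := [&& ~~ T i, ~~ T i.+1 & `[< loc P J (f (w i) (w i.+1)) >]].
pose I : finType := ({i : 'I_m.+1 | T i} * bool + {i : 'I_m | E i})%type.
pose g (i : I) : S := match i with
  | inl (t, b) => if b then x (w (val t)) else y (w (val t))
  | inr e => f (w (val e)) (w (val e).+1)
  end.
have cardI : #|I| = (\sum_(i < m.+1) T i * 2 + \sum_(i < m) E i)%N.
  rewrite card_sum card_prod card_bool !card_sig -!sum1_card -big_distrl /=.
  by congr (_ * 2 + _)%N; rewrite [LHS]big_mkcond; apply: eq_bigr => i _;
    rewrite inE; case: ifP.
exists I, g; set A := ideal_gen (range g).
have idA : is_ideal A by apply: ideal_gen_ideal.
have idJ := edge_ideal_ideal.
have Ax i : (i <= m)%N -> T i -> A (x (w i)).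
  rewrite -ltnS => lti Ti; apply: sub_ideal_gen.
  by exists (inl (exist _ (Ordinal lti) Ti, true)).
have Ay i : (i <= m)%N -> T i -> A (y (w i)).
  rewrite -ltnS => lti Ti; apply: sub_ideal_gen.
  by exists (inl (exist _ (Ordinal lti) Ti, false)).
have AE i : (i < m)%N -> E i -> A (f (w i) (w i.+1)).
  by move=> lti Ei; apply: sub_ideal_gen; exists (inr (exist _ (Ordinal lti) Ei)).
have ATl i b : (i <= m)%N -> T i -> A (f (w i) b).
  move=> lei Ti; apply: (idealB idA); first exact: idealMr idA (Ax _ lei Ti).
  exact: idealMr idA (Ay _ lei Ti).
have ATr i a : (i <= m)%N -> T i -> A (f a (w i)).
  by move=> lei Ti; rewrite edge_binomial_opp; apply: (idealN idA); apply: ATl.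
split.
- move=> [[[t /asboolP[Px Py]] b]|[e /and3P[_ _ /asboolP//]]] /=.
  by have [] := minimal_prime_vertex_loc minP Px Py; case: b.
(* An edge with unmarked ends jumps only over simplicial, hence unmarked, vertices, so its binomial
   is reached from consecutive ones by transitivity. *)
- have chain i j : (i < j)%N -> (j <= m)%N -> G (w i) (w j) ->
      loc P A (f (w i) (w j)).
    move=> ltij lejm Gij.
    have [Ti|nTi] := boolP (T i).
      by apply: (sub_loc prP); apply: ATl; rewrite // (leq_trans _ lejm) // ltnW.
    have [Tj|nTj] := boolP (T j).
      by apply: (sub_loc prP); apply: ATr.
    have nTc c : (i <= c)%N -> (c <= j)%N -> ~~ T c.
      rewrite leq_eqVlt => /orP[/eqP <- //|ltic].
      rewrite leq_eqVlt => /orP[/eqP -> //|ltcj].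
      have [_ simp] := w_edge ltic ltcj lejm Gij.
      by apply/asboolP; apply: minimal_prime_simplicial.
    have Gic c : (i < c)%N -> (c <= j)%N -> G (w i) (w c).
      move=> ltic; rewrite leq_eqVlt => /orP[/eqP -> //|ltcj].
      by have [] := w_edge ltic ltcj lejm Gij.
    have nP c : (i <= c)%N -> (c <= j)%N -> ~ (P (x (w c)) /\ P (y (w c))).
      by move=> leic lecj /asboolP Tc; have := nTc c leic lecj; rewrite /T Tc.
    have JP' := sub_loc prP.
    (* For c > i both w_c and w_(c+1) are adjacent to w_i: apply transitivity through w_i. *)
    have Ec c : (i <= c)%N -> (c < j)%N -> E c.
      move=> leic ltcj; apply/and3P; split.
      - exact: nTc c leic (ltnW ltcj).
      - exact: nTc c.+1 (leqW leic) ltcj.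
      apply/asboolP; move: leic; rewrite leq_eqVlt => /orP[/eqP eqic|ltic].
        by rewrite -eqic; apply: JP'; apply: edge_ideal_edge; apply: Gic; rewrite // eqic.
      apply: (@loc_edge_trans P J (w i)) => //; first by apply: nP; rewrite // ltnW.
        by apply: JP'; apply: edge_ideal_edge; apply: Gic; rewrite // ltnW.
      by apply: JP'; apply: edge_ideal_edge; apply: Gic; rewrite // ltnW.
    suff : forall c, (i < c)%N -> (c <= j)%N -> loc P A (f (w i) (w c)) by apply.
    elim=> [//|c IHc]; rewrite ltnS leq_eqVlt => /orP[/eqP <-|ltic] ltcj.
      by apply: (sub_loc prP); apply: AE; [apply: leq_trans lejm|apply: Ec].
    have idL := loc_ideal prP idA.
    apply: (@loc_edge_trans P A (w c)) => //; first by apply: nP; apply: ltnW.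
      by rewrite edge_binomial_opp; apply: (idealN idL); apply: IHc => //; apply: ltnW.
    apply: (sub_loc prP); apply: AE; first exact: leq_trans lejm.
    by apply: Ec; rewrite // ltnW.
  have idL := loc_ideal prP idA.
  apply: ideal_gen_min => // _ [a [b [Gab ->]]].
  have [i lei eqi] := w_surj a; have [j lej eqj] := w_surj b.
  move: Gab; rewrite -eqi -eqj; have [ltij|ltji|->] := ltngtP i j.
  + exact: chain.
  + rewrite adj_sym edge_binomial_opp => Gji.
    by apply: (idealN idL); apply: chain.
  + by rewrite adj_irr.
apply: (sub_loc prP); rewrite cardI.
(* Each marked vertex counts twice, once for each of the two factors of the path product in which it
   occurs, the end factors included. *)
have -> : (\sum_(i < m.+1) T i * 2 + \sum_(i < m) E i =
    T 0 + \sum_(i < m) (T i + T i.+1 + E i) + T m)%N.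
  have sumTr : (\sum_(i < m.+1) T i = \sum_(i < m) T i + T m)%N by rewrite big_ord_recr.
  have sumTl : (\sum_(i < m.+1) T i = T 0 + \sum_(i < m) T i.+1)%N by rewrite big_ord_recl.
  rewrite !big_split /= -big_distrl /= muln2 -addnn {1}sumTr sumTl.
  by ring.
apply: ideal_expM; last first.
  by case Tm : (T m); [apply: ideal_exp1; apply: Ax|].
apply: ideal_expM.
  by case T0 : (T 0); [apply: ideal_exp1; apply: Ay|].
apply: ideal_exp_prod => i _; have lti := ltn_ord i; have lei := ltnW lti.
case Ei : (E i).
  have /and3P[/negPf -> /negPf -> _] := Ei.
  by apply: ideal_exp1; apply: AE.
(* Both terms of the binomial contain one variable of each end. *)
case Ti : (T i); case Ti' : (T i.+1); rewrite ?addn0 ?add0n.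
- apply: (idealB (ideal_exp_ideal _ _)); apply: ideal_expM; apply: ideal_exp1.
  + exact: Ax. + exact: Ay. + exact: Ay. + exact: Ax.
- by apply: ideal_exp1; apply: ATl.
- by apply: ideal_exp1; apply: ATr.
- by [].
Qed.

End VertexOrder.
End EdgeIdeal.

(** * The initial monomial of the path product *)

Section PathProductLead.
Variables (k : fieldType) (n m : nat) (w : nat -> 'I_n) (pos : 'I_n -> nat).
Hypotheses (pos_le : forall a, (pos a <= m)%N) (posK : forall a, w (pos a) = a)
  (wK : forall i, (i <= m)%N -> pos (w i) = i).

(** The weight of x falls along the ordering and y weighs 0, so x_(w_i) y_(w_(i+1)) leads its
    binomial. *)
Definition path_weight (j : 'I_(n + n)) : nat :=
  if split j is inl a then (m.+1 - pos a)%N else 0%N.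

Lemma path_weight_x i : (i <= m)%N -> path_weight (lshift n (w i)) = (m.+1 - i)%N.
Proof.
by move=> lei; rewrite /path_weight -[lshift _ _]/(unsplit (inl _)) unsplitK wK.
Qed.

Lemma path_weight_y a : path_weight (rshift n a) = 0%N.
Proof. by rewrite /path_weight -[rshift _ _]/(unsplit (inr _)) unsplitK. Qed.

Lemma sum_positions (F : 'I_n -> 'X_{1..n + n}) :
  (\sum_(i < m.+1) F (w i) = \sum_a F a)%MM.
Proof.
pose ord a := Ordinal (pos_le a : (pos a < m.+1)%N).
rewrite [RHS](reindex (fun i : 'I_m.+1 => w i)) //.
exists ord => [i _|a _] /=; last exact: posK.
by apply: val_inj; rewrite /= wK // -ltnS.
Qed.

(** Each step uses x at its left and y at its right end; the end factors supply the missing y_(w_0)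
    and x_(w_m). *)
Lemma path_product_exponent :
  (U_(rshift n (w 0)) +
   \sum_(i < m) (U_(lshift n (w i)) + U_(rshift n (w i.+1))) +
   U_(lshift n (w m)) = [multinom 1 | j < n + n])%MM.
Proof.
have sumx : (\sum_a U_(lshift n a) =
    \sum_(i < m) U_(lshift n (w i)) + U_(lshift n (w m)))%MM.
  by rewrite -sum_positions big_ord_recr.
have sumy : (\sum_a U_(rshift n a) =
    U_(rshift n (w 0)) + \sum_(i < m) U_(rshift n (w i.+1)))%MM.
  by rewrite -sum_positions big_ord_recl.
transitivity (\sum_(j < n + n) U_(j))%MM.
  rewrite big_split_ord /= sumx sumy big_split /=.
  by apply/mnmP => j; rewrite !mnmDE; ring.
apply/mnmP => j; rewrite mnm_sumE mnmE (bigD1 j) //= mnm1E eqxx.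
by rewrite big1 ?addn0 // => i neq; rewrite mnm1E (negPf neq).
Qed.

Lemma path_product_lead :
  monic_lead path_weight (path_product k w m) [multinom 1 | j < n + n].
Proof.
rewrite -path_product_exponent.
apply: monic_leadM; last exact: monic_leadX.
apply: monic_leadM; first exact: monic_leadX.
apply: monic_lead_prod => i; rewrite /edge_binomial -!mpolyXD.
have lti := ltn_ord i; apply: monic_lead_binomial; first by rewrite !mdegD !mdeg1.
rewrite !weightD !weightU !path_weight_y !path_weight_x ?(ltnW lti) //.
by rewrite add0n addn0 subSS subSn ?(ltnW lti).
Qed.

End PathProductLead.

(** * Vertex orderings of pendant cliques graphs *)

Lemma increasing_enumeration (T : finType) (m : nat) (key : T -> nat) :
  injective key -> #|T| = m.+1 ->
  exists (w : nat -> T) (pos : T -> nat),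
    [/\ forall a, (pos a <= m)%N, forall a, w (pos a) = a,
        forall i, (i <= m)%N -> pos (w i) = i &
        forall i j, (i < j)%N -> (j <= m)%N -> (key (w i) < key (w j))%N].
Proof.
move=> inj_key cardT.
have [a0 _] : exists a0 : T, a0 \in T by apply/card_gt0P; rewrite cardT.
pose le a b := (key a <= key b)%N; pose s := sort le (enum T).
have size_s : size s = m.+1 by rewrite size_sort -cardE.
have uniq_s : uniq s by rewrite sort_uniq enum_uniq.
have mem_s a : a \in s by rewrite mem_sort mem_enum.
have le_trans : transitive le by move=> b a c; apply: leq_trans.
have sorted_s : sorted le s by apply: sort_sorted => a b; apply: leq_total.
exists (nth a0 s), (index^~ s); split=> [a|a|i lti|i j ltij ltj].
- by rewrite -ltnS -size_s index_mem.
- exact: nth_index.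
- by rewrite index_uniq // size_s.
rewrite -ltnS -size_s in ltj; have lti := ltn_trans ltij ltj.
rewrite ltn_neqAle (inj_eq inj_key) nth_uniq // ltn_eqF //=.
exact: (sorted_ltn_nth le_trans a0 sorted_s).
Qed.

(* A vertex of the clique attached via v_i gets the key (i, j), with j = 0
   exactly for the path vertex v_i itself. *)
Lemma clique_joins_key l (V : finType) (H : graph V) (pv : 'I_l -> V) used :
  clique_joins_of_path H pv used ->
  exists key : V -> 'I_l * nat,
    [/\ injective key, forall i, key (pv i) = (i, 0%N),
        forall a, (0 < (key a).2)%N -> (key a).1 \in used &
        forall a b, H a b = (a != b) && (((key a).1 == (key b).1) ||
          [&& (key a).2 == 0%N, (key b).2 == 0%N & path_adj (key a).1 (key b).1])].
Proof.
elim=> [|{}V {}H {}pv {}used v t _ [key [inj_key key_pv key_used adjE]] nv _].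
  exists (fun i => (i, 0%N)); split=> [i j [] //||//|i j /=] //.
  by case: eqP => [->|_] //=; rewrite path_adj_irr.
exists (fun a : (V + 'I_t.-1)%type =>
  match a with inl a => key a | inr j => (v, (j : nat).+1) end).
(* As v is not yet used, only its path vertex has a key in block v, so the new keys are fresh. *)
have on_v a : (key a).1 = v -> a = pv v.
  move=> eqv; apply: inj_key; rewrite key_pv [key a]surjective_pairing eqv.
  case def_j : (key a).2 => [//|j].
  by move: nv; rewrite -eqv key_used // def_j.
split=> [[a|i] [b|j]||[a|i]|[a|i] [b|j]] //=.
- by move/inj_key ->.
- by move=> eqk; have := on_v a; rewrite eqk => /(_ erefl) eqa; move: eqk; rewrite eqa key_pv.
- by move=> eqk; have := on_v b; rewrite -eqk => /(_ erefl) eqb; move: eqk; rewrite eqb key_pv.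
- by move=> [/val_inj ->].
- by move/key_used => kU; rewrite in_setU1 kU orbT.
- by rewrite setU11.
- rewrite andbF orbF; apply/eqP/eqP => [->|/on_v //].
  by rewrite key_pv.
- rewrite orbF; apply/eqP/eqP => [->|/esym/on_v //].
  by rewrite key_pv.
- by rewrite eqxx andbT.
Qed.

(** Sort the keys lexicographically. Edges between different blocks join path vertices, which head
    consecutive blocks; so a vertex c jumped over lies in the block of a without heading it, and all
    its neighbours lie in that clique. *)
Lemma pendant_cliques_order n (G : graph 'I_n) : pendant_cliques_graph G ->
  (0 < n)%N /\ exists key : 'I_n -> nat, injective key /\
    forall a c b, (key a < key c < key b)%N -> G a b -> G a c /\ simplicial G c.
Proof.
move=> [l [V [H [pv [used [l_gt0 joins [f [f' fK f'K] GE]]]]]]].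
have [key [inj_key _ _ adjE]] := clique_joins_key joins.
split; first by case: n G f f' fK f'K GE => // ? f; case: (f (pv (Ordinal l_gt0))).
pose kb a := (key (f' a)).1; pose kj a := (key (f' a)).2.
have {GE adjE}adjE a b : G a b = (a != b) &&
    ((kb a == kb b) || [&& kj a == 0%N, kj b == 0%N & path_adj (kb a) (kb b)]).
  by rewrite -{1}[a]f'K -{1}[b]f'K -GE adjE (can_eq f'K).
(* M exceeds every second component, so [code] is an expansion in base M. *)
pose M := (\max_a kj a).+1.
have ltM a : (kj a < M)%N by rewrite ltnS (leq_bigmax a).
pose code a := (kb a * M + kj a)%N.
have codeK a : (code a %/ M)%N = kb a :> nat.
  by rewrite divnMDl // divn_small ?addn0.
have code_mono a b : (code a <= code b)%N -> (kb a <= kb b)%N.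
  by move=> le_ab; rewrite -!codeK leq_div2r.
have code_inj : injective code.
  move=> a b eqab; have eqb : kb a = kb b by apply: val_inj; rewrite /= -!codeK eqab.
  apply: (can_inj f'K); apply: inj_key.
  rewrite [key (f' a)]surjective_pairing [RHS]surjective_pairing.
  congr pair => //; move/eqP: eqab; rewrite /code eqb eqn_add2l.
  by move/eqP.
exists code; split=> // a c b /andP[ltac ltcb] Gab.
have lt_same u v : kb u = kb v -> (code u < code v)%N -> (0 < kj v)%N.
  by move=> equv; rewrite /code equv ltn_add2l; apply: leq_ltn_trans.
have eqac : kb c = kb a.
  apply/eqP; rewrite eqE /= eqn_leq (code_mono _ _ (ltnW ltac)) andbT.
  move: Gab; rewrite adjE => /andP[_ /orP[/eqP ->|/and3P[ja jb]]].
    exact/code_mono/ltnW.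
  (* If b heads the next block, c lies in an earlier one; the other direction contradicts the order
     of a and b. *)
  rewrite /path_adj => /orP[/eqP eqb|/eqP eqa].
    rewrite -ltnS eqb -(ltn_pmul2r (ltn0Sn _ : (0 < M)%N)).
    apply: leq_ltn_trans (leq_addr (kj c) _) _.
    by move: ltcb; rewrite {2}/code (eqP jb) addn0.
  have := code_mono _ _ (ltnW (ltn_trans ltac ltcb)).
  by rewrite -eqa ltnn.
have jc := lt_same _ _ (esym eqac) ltac.
have same_block u : G c u -> kb u = kb c.
  by rewrite adjE [kj c == _]gtn_eqF //= orbF => /andP[_ /eqP].
split.
  rewrite adjE eqac eqxx andbT; apply/eqP => eqac'.
  by rewrite eqac' ltnn in ltac.
move=> u v /same_block equ /same_block eqv neq.
by rewrite adjE neq equ eqv eqxx.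
Qed.

Theorem corollary3p8 (k : fieldType) (p : nat) (charkp : p \in [pchar k])
  (n : nat) (G : graph 'I_n) (pcG : pendant_cliques_graph G) :
  symbolic_F_split (pchar_mpoly n charkp) (binomial_edge_ideal k G).
Proof.
have [n_gt0 [key [inj_key btw]]] := pendant_cliques_order pcG.
have [|w [pos [pos_le posK wK w_mono]]] :=
  @increasing_enumeration _ n.-1 _ inj_key; first by rewrite card_ord prednK.
have lead := path_product_lead k pos_le posK wK.
have [h [hD hZ h1]] := frobenius_splitting charkp lead.
apply: (symbolic_F_split_local _ hD hZ h1).
- exact: noetherian_mpoly.
- exact: edge_ideal_ideal.
move=> P minP; apply: path_product_local minP => [a|i c j ltic ltcj lej].
  by exists (pos a).
have lec := leq_trans (ltnW ltcj) lej.
by apply: btw; rewrite !w_mono.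
Qed.
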